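(* Let $G\in\mathcal{G}$ and $A=A^*\in M(d\times d,\overline{\mathbb{Q}}G)$. Let $\lambda\in\mathbb{R}$ be a transcendental number such that for every $n\in\mathbb{N}$ there is a rational number $p_n/q_n$ with $q_n\ge 2$ such that $$0<\left|\lambda-\frac{p_n}{q_n}\right|\le\frac{1}{q_n^{n}}.$$ Then $\lambda$ is not an eigenvalue of $A$ acting on $l^2(G)^d$.
   Context: $\overline{\mathbb{Q}}$ is the field of algebraic numbers in $\mathbb{C}$. For a discrete group $G$, a matrix $A\in M(d\times d,\mathbb{C}G)$ acts by left convolution as a bounded operator on $l^2(G)^d$; $A^*$ is the adjoint operator, which is again given by a matrix over $\mathbb{C}G$ (transpose and apply $\sum_g\alpha_gg\mapsto\sum_g\overline{\alpha_{g^{-1}}}\,g$ entrywise). Directed system: the index set $I$ is partially ordered, any two $i,j\in I$ admit $k\in I$ with $i<k$, $j<k$, and there are compatible homomorphisms $G_i\to G_j$ for $i<j$ (for direct limits) or $G_j\to G_i$ for $i<j$ (for inverse limits). Generalized amenable extension: let $G$ be a finitely generated discrete group with a finite symmetric set of generators $S$, and let $H$ be a normal subgroup of $G$. $G$ is a generalized amenable extension of $H$ if there is a set $X$ with a free left $G$-action and a commuting free right $H$-action, and a sequence of $H$-invariant subsets $X_1\subset X_2\subset\cdots\subset X$ with $\bigcup_k X_k=X$, $|X_k/H|<\infty$ for every $k$, and $\frac{|(S\cdot X_k-X_k)/H|}{|X_k/H|}\to 0$ as $k\to\infty$ (here $S\cdot X_k-X_k$ is the set difference). $\mathcal{G}$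 is the smallest class of groups which contains the trivial group and is closed under: (i) if $H\in\mathcal{G}$ and $G$ is a generalized amenable extension of $H$, then $G\in\mathcal{G}$; (ii) if $H\in\mathcal{G}$ and $U$ is a subgroup of $H$, then $U\in\mathcal{G}$; (iii) if $G$ is the direct or inverse limit of a directed system of groups $G_i\in\mathcal{G}$, then $G\in\mathcal{G}$. *)

(* Defs.v *)
From HB Require Import structures.
From mathcomp Require Import all_boot all_order all_algebra finmap.
From mathcomp Require Import complex.
From mathcomp Require Import all_classical all_reals all_analysis.

Set Implicit Arguments.
Unset Strict Implicit.
Unset Printing Implicit Defensive.
Import Order.TTheory GRing.Theory Num.Theory.
Import numFieldNormedType.Exports.
Local Open Scope classical_set_scope.
Local Open Scope ring_scope.

(* A subgroup H of G is represented by a group H together with an injective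
   morphism H -> G. *)
Definition normal_embedding (H G : groupType) (f : {multiplicative H -> G}) :
    Prop :=
  injective f /\ forall (g : G) (h : H), exists h' : H, (f h ^ g)%g = f h'.

Definition is_subgroup (G : groupType) (K : set G) : Prop :=
  [/\ K 1%g, (forall x y, K x -> K y -> K (x * y)%g)
    & (forall x, K x -> K x^-1%g)].

Definition symmetric_generators (G : groupType) (S : set G) : Prop :=
  [/\ finite_set S, (forall s, S s -> S s^-1%g)
    & forall K : set G, is_subgroup K -> S `<=` K -> K = setT].

Definition free_left_action (G : groupType) (X : Type) (l : G -> X -> X) :
    Prop :=
  [/\ (forall x, l 1%g x = x), (forall g h x, l (g * h)%g x = l g (l h x))
    & (forall g x, l g x = x -> g = 1%g)].

Definition free_right_action (H : groupType) (X : Type) (r : X -> H -> X) :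
    Prop :=
  [/\ (forall x, r x 1%g = x), (forall x h k, r x (h * k)%g = r (r x h) k)
    & (forall h x, r x h = x -> h = 1%g)].

(* Y / H for an H-invariant subset Y of X. *)
Definition orbits (H : groupType) (X : Type) (r : X -> H -> X) (Y : set X) :
    set (set X) :=
  [set [set r x h | h in [set: H]] | x in Y].

Definition card_orbits (H : groupType) (X : Type) (r : X -> H -> X)
    (Y : set X) : nat :=
  #|` fset_set (orbits r Y)|%fset.

(* The nonemptiness of the X_k makes the quotients |(S X_k - X_k)/H| / |X_k/H|
   meaningful; it must be required because x / 0 = 0 here.  The right H-action
   r is not assumed to be related to f. *)
Definition generalized_amenable_extension (R : realType) (H G : groupType)
    (f : {multiplicative H -> G}) : Prop :=
  normal_embedding f /\
  exists (S : set G) (X : Type) (l : G -> X -> X) (r : X -> H -> X)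
         (Xs : nat -> set X),
  [/\ symmetric_generators S,
      free_left_action l /\ free_right_action r,
      (forall g x h, r (l g x) h = l g (r x h)),
      [/\ (forall k x h, Xs k x -> Xs k (r x h)),
          (forall k, Xs k `<=` Xs k.+1),
          \bigcup_k Xs k = setT,
          (forall k, Xs k !=set0)
        & (forall k, finite_set (orbits r (Xs k)))]
    & (card_orbits r ([set l s x | s in S & x in Xs k] `\` Xs k))%:R
        / (card_orbits r (Xs k))%:R @[k --> \oo] --> (0 : R)].

Section Limits.
Variables (disp : Order.disp_t) (I : porderType disp) (Gs : I -> groupType).

Definition directed : Prop := forall i j : I, exists2 k, (i < k)%O & (j < k)%O.

Definition direct_system
    (f : forall i j, (i < j)%O -> {multiplicative Gs i -> Gs j}) : Prop :=
  forall i j k (ij : (i < j)%O) (jk : (j < k)%O) (ik : (i < k)%O) x,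
    f j k jk (f i j ij x) = f i k ik x.

Definition cocone (f : forall i j, (i < j)%O -> {multiplicative Gs i -> Gs j})
    (G : groupType) (phi : forall i, {multiplicative Gs i -> G}) : Prop :=
  forall i j (ij : (i < j)%O) x, phi j (f i j ij x) = phi i x.

Definition is_direct_limit
    (f : forall i j, (i < j)%O -> {multiplicative Gs i -> Gs j})
    (G : groupType) (phi : forall i, {multiplicative Gs i -> G}) : Prop :=
  cocone f phi /\
  forall (K : groupType) (psi : forall i, {multiplicative Gs i -> K}),
    cocone f psi ->
    exists2 u : {multiplicative G -> K}, (forall i x, u (phi i x) = psi i x)
      & forall v : {multiplicative G -> K},
          (forall i x, v (phi i x) = psi i x) -> v =1 u.

Definition inverse_system
    (f : forall i j, (i < j)%O -> {multiplicative Gs j -> Gs i}) : Prop :=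
  forall i j k (ij : (i < j)%O) (jk : (j < k)%O) (ik : (i < k)%O) x,
    f i j ij (f j k jk x) = f i k ik x.

Definition cone (f : forall i j, (i < j)%O -> {multiplicative Gs j -> Gs i})
    (G : groupType) (phi : forall i, {multiplicative G -> Gs i}) : Prop :=
  forall i j (ij : (i < j)%O) x, f i j ij (phi j x) = phi i x.

Definition is_inverse_limit
    (f : forall i j, (i < j)%O -> {multiplicative Gs j -> Gs i})
    (G : groupType) (phi : forall i, {multiplicative G -> Gs i}) : Prop :=
  cone f phi /\
  forall (K : groupType) (psi : forall i, {multiplicative K -> Gs i}),
    cone f psi ->
    exists2 u : {multiplicative K -> G}, (forall i x, phi i (u x) = psi i x)
      & forall v : {multiplicative K -> G},
          (forall i x, phi i (v x) = psi i x) -> v =1 u.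

End Limits.

(* R only serves to express the convergence in generalized_amenable_extension. *)
Inductive classG (R : realType) : groupType -> Prop :=
| classG_trivial (G : groupType) : (forall x : G, x = 1%g) -> classG R G
| classG_extension (H G : groupType) (f : {multiplicative H -> G}) :
    classG R H -> generalized_amenable_extension R f -> classG R G
| classG_subgroup (U H : groupType) (f : {multiplicative U -> H}) :
    classG R H -> injective f -> classG R U
| classG_direct_limit (disp : Order.disp_t) (I : porderType disp)
    (Gs : I -> groupType)
    (f : forall i j, (i < j)%O -> {multiplicative Gs i -> Gs j})
    (G : groupType) (phi : forall i, {multiplicative Gs i -> G}) :
    directed I -> direct_system f -> (forall i, classG R (Gs i)) ->
    is_direct_limit f phi -> classG R G
| classG_inverse_limit (disp : Order.disp_t) (I : porderType disp)
    (Gs : I -> groupType)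
    (f : forall i j, (i < j)%O -> {multiplicative Gs j -> Gs i})
    (G : groupType) (phi : forall i, {multiplicative G -> Gs i}) :
    directed I -> inverse_system f -> (forall i, classG R (Gs i)) ->
    is_inverse_limit f phi -> classG R G.

(* The finitely supported function a stands for the element \sum_g a(g) g of the
   complex group ring. *)
Notation group_ring R G := {fsfun G -> complex R with 0%R}.

Section GroupRing.
Variables (R : realType) (G : groupType).

Definition gr_star (a : group_ring R G) : group_ring R G :=
  [fsfun g in [fset h^-1%g | h in finsupp a]%fset => (a (g^-1)%g)^*].

(* The matrix of the adjoint operator for the action gr_act below. *)
Definition gr_adjoint (d : nat) (A : 'M[group_ring R G]_d) :
    'M[group_ring R G]_d :=
  \matrix_(i, j) gr_star (A j i).

(* The entries of A lie in Qbar[G], with Qbar the algebraic numbers in C. *)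
Definition algebraic_coefficients (d : nat) (A : 'M[group_ring R G]_d) : Prop :=
  forall i j g, algebraicOver (ratr : rat -> complex R) (A i j g).

Definition in_l2 (d : nat) (x : 'I_d -> G -> complex R) : Prop :=
  forall i, (\esum_(g in [set: G]) ((ComplexField.Normc.normc (x i g) ^+ 2)%:E) < +oo)%E.

(* Left convolution: (a * x)(g) = \sum_h a(h) x(h^-1 g). *)
Definition gr_act (d : nat) (A : 'M[group_ring R G]_d)
    (x : 'I_d -> G -> complex R) : 'I_d -> G -> complex R :=
  fun i g => \sum_(j < d) \sum_(h <- finsupp (A i j))
               A i j h * x j (h^-1 * g)%g.

Definition is_eigenvalue (d : nat) (A : 'M[group_ring R G]_d) (z : complex R) :
    Prop :=
  exists x : 'I_d -> G -> complex R,
    [/\ in_l2 x, (exists i g, x i g != 0)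
      & forall i g, gr_act A x i g = z * x i g].

End GroupRing.

(* Main.v *)
Require Import Defs.
From HB Require Import structures.
From mathcomp Require Import all_boot all_order all_algebra finmap.
From mathcomp Require Import separable complex.
From mathcomp Require Import all_classical all_reals all_analysis.
From mathcomp Require Import ring lra zify.
Import Order.TTheory GRing.Theory Num.Theory.
Import numFieldNormedType.Exports.
Local Open Scope ring_scope.

Set Implicit Arguments.
Unset Strict Implicit.
Unset Printing Implicit Defensive.

(** Suppose that [A x = lambda x] with [x <> 0] in l^2.  If [N] is a common
denominator of the coefficients of [A], then [V = N (q A - p)] has algebraic
integer coefficients and the eigenvalue [mu = N (q lambda - p)], which is
nonzero but at most [N q^(1-n)] when [p/q] is the [n]-th approximation of
[lambda].  The proof shows that such a [V] has few eigenvalues that small, in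
a way that survives the passage to an infinite group.

For matrices the reason is arithmetic.  Let [B] be a Hermitian matrix of size
[m] over [Z[theta]].  Up to sign, the product of its nonzero eigenvalues is the
lowest nonzero coefficient of its characteristic polynomial, hence a nonzero
element of [Z[theta]]; its norm is a nonzero integer, and its conjugates are at
most [(1 + k)^m], where [k] bounds the row sums of the conjugates of [B].  So
the sum of [ln |t|] over the nonzero eigenvalues [t] is at least
[- m e ln (1 + k)], with [e] the number of other conjugates
([sum_ln_eigenvalues]): at most a fraction of order [ln k / ln (1/|mu|)] of
the eigenvalues has the size of [mu].  Here [k] is of order [q], so this
fraction is of order [1/n].

Finite matrices enter because every group of the class is sofic
([classG_sofic]): it acts partially on finite sets that look like the group
around almost all of their points.  This property passes to subgroups and to
limits since it only concerns finite subsets of the group, and to a generalized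
amenable extension [G] of [H] because a Foelner set [X_k] of [X], on which [G]
acts up to its boundary, is a finite union of [H]-orbits, each of which can be
replaced by a finite model of [H].

On a finite model [T] of [G], the matrix [V] becomes a Hermitian matrix [B]
indexed by [d] copies of [T].  Around a good point [v], the vector [x] can be
transplanted to [T], and it looks there like an eigenvector of [B] for [mu].
If [sg] is a real polynomial with [sg(mu) = 1], Cauchy-Schwarz then bounds from
below the norm of the row of [sg(B)] at [v] by [|x(1)| / |x|].  When [sg] is
peaked at [mu] ([peak_poly]), the sum of the squares of these norms, which is
the trace of [sg(B)^2], is bounded from above by the arithmetic estimate.
Comparing both bounds ([sofic_eigenvector_bound]) makes [|x(1)|^2] of order
[1/n] for every [n], while any nonzero value of [x] can be moved to [1]. *)

(** * Sofic groups and local embeddings *)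

(** The map [beta] is a chart at [v]: it identifies the part [E] of the group
with a piece of [T] on which [act] is left multiplication. *)
Definition good_point (G : groupType) (E : seq G) (T : Type)
    (act : G -> T -> option T) (v : T) : Prop :=
  exists beta : G -> T,
    [/\ beta 1%g = v, {in E &, injective beta}
      & forall g x, g \in E -> x \in E -> (g * x)%g \in E ->
          act g (beta x) = Some (beta (g * x)%g)].

(** Soficity with partial actions: [act g] and [act g^-1] are required to be
exactly inverse to each other, so that the matrix of a self-adjoint element of
the group ring is exactly Hermitian on every model; the multiplicativity of the
action is only asked around most points.  The bound on the proportion of bad
points is [1 / n]. *)
Definition sofic (G : groupType) : Prop :=
  forall (E : seq G) (n : nat), exists (T : finType) (act : G -> T -> option T),
    [/\ (0 < #|T|)%N,
        (forall g u v, act g u = Some v -> act g^-1%g v = Some u)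
      & (#|[set v | ~~ `[< good_point E act v >]]| * n <= #|T|)%N].

Definition partial_morphism (G H : groupType) (E : seq G) (psi : G -> H) :=
  {in E &, injective psi} /\
  forall x y, x \in E -> y \in E -> (x * y)%g \in E ->
    psi (x * y)%g = (psi x * psi y)%g.

(** A finite piece of [G] is all that the definition of soficity sees, so a model
of a group that contains a copy of this piece is a model of [G]. *)
Lemma sofic_local (G : groupType) :
  (forall E : seq G, exists H : groupType, sofic H /\
     exists psi : G -> H, partial_morphism E psi) -> sofic G.
Proof.
move=> locG E n; pose E' := (1 :: E ++ [seq x^-1 | x <- E])%g.
have E'1 : 1%g \in E' by rewrite inE eqxx.
have EE' : {subset E <= E'} by move=> x xE; rewrite inE mem_cat xE orbT.
have E'V x : x \in E' -> x^-1%g \in E'.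
  rewrite !inE !mem_cat invg_eq1 => /orP[->//|/orP[xE|/mapP[y yE ->]]].
    by rewrite map_f ?orbT.
  by rewrite invgK yE orbT.
have [H [sofH [psi [psi_inj psiM]]]] := locG E'.
have psi1 : psi 1%g = 1%g.
  by apply: (mulgI (psi 1%g)); rewrite -psiM ?mulg1.
have psiV x : x \in E' -> psi x^-1%g = (psi x)^-1%g.
  move=> xE; apply: (mulgI (psi x)).
  by rewrite mulgV -psiM ?mulgV ?E'V.
have [Y [act [Y_gt0 actV bad]]] := sofH [seq psi x | x <- E'] n.
exists Y, (fun g u => if g \in E' then act (psi g) u else None); split=> //.
  move=> g u v; case: ifP => // gE'; rewrite E'V // psiV //; exact: actV.
apply: leq_trans bad; rewrite leq_mul2r subset_leq_card ?orbT //.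
apply/fintype.subsetP => v; rewrite !inE; apply: contra => /asboolP [beta [b1 binj bM]].
apply/asboolP; exists (beta \o psi); split=> /=.
- by rewrite psi1.
- by move=> x y /EE' xE /EE' yE /binj e; apply: psi_inj => //; apply: e; apply: map_f.
- move=> g x /EE' gE /EE' xE /EE' gxE; rewrite gE bM ?map_f //.
    by rewrite psiM.
  by rewrite -psiM // map_f.
Qed.

Lemma sofic_trivial (G : groupType) : (forall x : G, x = 1%g) -> sofic G.
Proof.
move=> G1 E n; exists unit, (fun _ u => Some u); split=> //.
- by rewrite card_unit.
- rewrite (_ : [set _ | _] = finset.set0) ?cards0 //; apply/finset.setP => -[]; rewrite !inE.
  apply/negbTE; rewrite negbK; apply/asboolP; exists (fun _ => tt); split=> //.
  by move=> x y _ _ _; rewrite (G1 x) (G1 y).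
Qed.

(** * Generalized amenable extensions *)

Section AmenableExtension.
Variables (H G : groupType) (X : Type) (l : G -> X -> X) (r : X -> H -> X).
Hypotheses (lfree : free_left_action l) (rfree : free_right_action r).
Hypothesis lrC : forall g x h, r (l g x) h = l g (r x h).

Let orb (x : X) : set X := [set r x h | h in [set: H]]%classic.

Let l1 x : l 1%g x = x. Proof. by case: lfree. Qed.
Let lM g h x : l (g * h)%g x = l g (l h x). Proof. by case: lfree. Qed.
Let r1 x : r x 1%g = x. Proof. by case: rfree. Qed.
Let rM x h k : r x (h * k)%g = r (r x h) k. Proof. by case: rfree. Qed.
Let lVK g x : l g^-1%g (l g x) = x. Proof. by rewrite -lM mulVg l1. Qed.
Let l_inj g : injective (l g).
Proof. by move=> x y e; rewrite -(lVK g x) e lVK. Qed.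
Let rK x h : r (r x h) h^-1%g = x. Proof. by rewrite -rM mulgV r1. Qed.

Let l_free g h x : l g x = l h x -> g = h.
Proof.
case: lfree => _ _ lf e; suff: (h^-1 * g)%g = 1%g.
  by move/(congr1 (fun z => h * z)%g); rewrite mulgA mulgV mul1g mulg1.
by apply: (lf _ x); rewrite lM e lVK.
Qed.

Let r_free h k x : r x h = r x k -> h = k.
Proof.
case: rfree => _ _ rf e; suff: (h * k^-1)%g = 1%g.
  by move/(congr1 (fun z => z * k)%g); rewrite -mulgA mulVg mul1g mulg1.
by apply: (rf _ x); rewrite rM e rK.
Qed.

Let orb_refl x : orb x x. Proof. by exists 1%g. Qed.
Let orb_r x h : orb (r x h) = orb x.
Proof.
apply/seteqP; split=> y [k _ <-].
  by exists (h * k)%g => //; rewrite rM.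
by exists (h^-1 * k)%g => //; rewrite -rM mulgA mulgV mul1g.
Qed.
Let orb_eq x y : orb x = orb y -> exists h, x = r y h.
Proof. by move=> e; have := orb_refl x; rewrite e => -[h _ <-]; exists h. Qed.
Let orb_l g x y : orb (l g x) = orb (l g y) -> orb x = orb y.
Proof. by move/orb_eq => [h]; rewrite lrC => /l_inj ->; rewrite orb_r. Qed.

Variable x0 : X.

Let repP : exists rep : set X -> X, forall x, orb (rep (orb x)) = orb x.
Proof.
have [rep repP] : exists rep : set X -> X,
    forall O, (exists x, O = orb x) -> O (rep O).
  have : forall O : set X, exists y, (exists x, O = orb x) -> O y; last first.
    by case/boolp.choice => rep h; exists rep.
  move=> O; have [[x ->]|nO] := pselect (exists x, O = orb x); first by exists x.
  by exists x0 => /nO.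
exists rep => x; have [h _ <-] : orb x (rep (orb x)) by apply: repP; exists x.
by rewrite orb_r.
Qed.

Let coordP (rep : set X -> X) : (forall x, orb (rep (orb x)) = orb x) ->
  exists kap : X -> H, forall x, x = r (rep (orb x)) (kap x).
Proof.
move=> rp.
have : forall x, exists h, x = r (rep (orb x)) h by move=> x; exact/orb_eq/esym/rp.
by case/boolp.choice => kap h; exists kap.
Qed.

Variables (Xs : nat -> set X) (S : set G).
Hypotheses (Xr : forall k x h, Xs k x -> Xs k (r x h))
  (Xn0 : forall k, (Xs k !=set0)%classic)
  (Xfin : forall k, finite_set (orbits r (Xs k)))
  (Sgen : symmetric_generators S).

Let bdy k : set X := ([set l s x | s in S & x in Xs k] `\` Xs k)%classic.
Hypothesis folner : forall n : nat, exists k0 : nat, forall k, (k0 <= k)%N ->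
  (card_orbits r (bdy k) * n <= card_orbits r (Xs k))%N.

Let V k : {fset set X} := fset_set (orbits r (Xs k)).

Let inV k O : O \in V k <-> exists2 x, Xs k x & orb x = O.
Proof. by rewrite in_fset_set ?inE //; split=> -[x]; exists x. Qed.

Let Xorb k x : orb x \in V k <-> Xs k x.
Proof.
rewrite inV; split=> [[y yk /esym/orb_eq [h ->]]|]; first exact: Xr.
by exists x.
Qed.

Let V_gt0 k : (0 < #|` V k|)%N.
Proof.
have [x xk] := Xn0 k; rewrite cardfs_gt0; apply/fset0Pn.
by exists (orb x); apply/Xorb.
Qed.

Section Rep.
(* [rep] picks a point in each [H]-orbit, and [kap] is the coordinate of a point
   in its orbit with respect to that choice. *)
Variables (rep : set X -> X) (kap : X -> H).
Hypotheses (rp : forall x, orb (rep (orb x)) = orb x)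
  (kapP : forall x, x = r (rep (orb x)) (kap x)).

Let repV k O : O \in V k -> orb (rep O) = O.
Proof. by case/inV=> x _ <-; rewrite rp. Qed.

(* The orbits of [X_k] that [g] pushes out of [X_k]. *)
Let D k g : {fset set X} := [fset O in V k | `[< ~ Xs k (l g (rep O)) >]]%fset.

Let inD k g O : O \in D k g <-> O \in V k /\ ~ Xs k (l g (rep O)).
Proof. by rewrite !inE /=; split=> [/andP[? /asboolP]|[? /asboolP ?]]; [split|apply/andP]. Qed.

Let card_image_D k (A : {fset set X}) (h : G) :
  (A `<=` V k)%fset -> #|` [fset orb (l h (rep O)) | O in A]%fset| = #|` A|.
Proof.
move=> /fsubsetP AV; apply: card_in_imfset => O O' OA O'A /= /orb_l.
by rewrite !(@repV k) // AV.
Qed.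

Let DV k g : (D k g `<=` V k)%fset.
Proof. by apply/fsubsetP => O /inD[]. Qed.

Let D_M k g h : (#|` D k (g * h)%g| <= #|` D k g| + #|` D k h|)%N.
Proof.
pose B := (D k (g * h)%g `\` D k h)%fset.
have BV : (B `<=` V k)%fset by apply: fsubset_trans (DV k (g * h)%g); apply: fsubsetDl.
have : (#|` B| <= #|` D k g|)%N.
  rewrite -(card_image_D h BV); apply: fsubset_leq_card.
  apply/fsubsetP => _ /imfsetP[ O /= + ->]; rewrite inE => /andP[ngh /inD[ OV gh]].
  have hO : Xs k (l h (rep O)).
    by apply: contrapT => nh; move/negP: ngh; apply; apply/inD.
  apply/inD; split; first exact/Xorb.
  have [c ->] := orb_eq (rp (l h (rep O))).
  by move=> /(Xr c^-1%g); rewrite -lrC rK -lM.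
have := cardfsID (D k h) (D k (g * h)%g).
have : (#|` D k (g * h)%g `&` D k h| <= #|` D k h|)%fset%N.
  by apply: fsubset_leq_card; apply: fsubsetIr.
rewrite -/B; lia.
Qed.

Let D_S k s : S s -> (#|` D k s| <= card_orbits r (bdy k))%N.
Proof.
move=> Ss; rewrite -(card_image_D s (DV k s)); apply: fsubset_leq_card.
have bfin : finite_set (orbits r (bdy k)).
  have [Sfin _ _] := Sgen.
  pose f g O := orb (l g (rep O)).
  apply: (@sub_finite_set _ _ [set f g O | g in S & O in orbits r (Xs k)]%classic);
    last by apply: finite_image2 => //; exact: Xfin.
  move=> O [x [[g Sg [y yk <-]] _] <-].
  exists g => //; exists (orb y); first by exists y.
  by have [c ec] := orb_eq (rp y); rewrite /f ec -lrC; exact: orb_r.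
apply/fsubsetP => _ /imfsetP[ O /= /inD[ OV nO] ->].
rewrite in_fset_set // inE; exists (l s (rep O)) => //; split=> //.
exists s => //; exists (rep O) => //; apply/Xorb; by rewrite (@repV k).
Qed.

Let small g := forall n, exists k0 : nat, forall k, (k0 <= k)%N ->
  (#|` D k g| * n <= #|` V k|)%N.

(* The elements that move a vanishing proportion of the orbits of [X_k] out of
   [X_k], and whose inverses do so too, form a subgroup; the Foelner condition
   puts the generators in it. *)
Let small_all g : small g.
Proof.
have [Sfin SV Sgen'] := Sgen.
suff : ([set g | small g /\ small g^-1%g] = setT)%classic.
  by move/seteqP=> [_ /(_ g I)[]].
have D1 k : D k 1%g = fset0.
  apply/fsetP => O; rewrite inE; apply/negP => /inD[ OV]; rewrite l1 => -[].
  by apply/Xorb; rewrite (@repV k).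
have smallM g1 g2 : small g1 -> small g2 -> small (g1 * g2)%g.
  move=> s1 s2 n; have [k1 h1] := s1 n.*2; have [k2 h2] := s2 n.*2.
  exists (maxn k1 k2) => k; rewrite geq_max => /andP[/h1 + /h2].
  have := D_M k g1 g2; nia.
have smallS s : S s -> small s.
  move=> Ss n; have [k0 hk0] := folner n; exists k0 => k /hk0.
  by have := @D_S k s Ss; rewrite /card_orbits -/(V k); nia.
apply: Sgen'; first split => /=.
- by rewrite invg1; split=> n; exists 0%N => k _; rewrite D1.
- by move=> x y [sx sx'] [sy sy']; rewrite invgM; split; apply: smallM.
- by move=> x [sx sx']; rewrite invgK.
- by move=> s Ss; split; apply: smallS => //; apply: SV.
Qed.

Let small_seq (E : seq G) n : exists k, (\sum_(g <- E) #|` D k g| * n <= #|` V k|)%N.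
Proof.
suff : forall m, exists k0 : nat, forall k, (k0 <= k)%N ->
    ((\sum_(g <- E) #|` D k g|) * m <= #|` V k|)%N.
  by move=> /(_ n) [k] /(_ k (leqnn k)); exists k; rewrite -big_distrl.
elim: E => [|g E IH] m; first by exists 0%N => k _; rewrite big_nil.
have [k1 h1] := IH m.*2; have [k2 h2] := small_all g m.*2.
exists (maxn k1 k2) => k; rewrite geq_max => /andP[/h1 + /h2].
rewrite big_cons; nia.
Qed.

Let kap_r x h : kap (r x h) = (kap x * h)%g.
Proof.
apply: (r_free (x := rep (orb x))); rewrite rM -kapP -(orb_r x h) -kapP //.
Qed.

Let rep_orb x : rep (orb x) = r x (kap x)^-1%g.
Proof. by rewrite -[LHS](rK _ (kap x)) -kapP. Qed.

(** Let [x] be the representative of an orbit and [l g x = r x' h] with [x'] the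
representative of another one.  Then [g] sends the point [(x, v)] of the model
to [(x', h v)], where [h] acts on a model of [H], as long as [x'] lies in [X_k].
Freeness of both actions makes the resulting charts injective. *)
Lemma extension_sofic_rep : sofic H -> sofic G.
Proof.
move=> sofH E n; have [k hk] := small_seq E n.*2.
have kap_rep O : O \in V k -> kap (rep O) = 1%g.
  move=> OV; apply: (r_free (x := rep O)); rewrite r1.
  by rewrite -{1}(repV OV) -kapP.
pose EH1 := [seq kap (l g (rep W)) | g <- E, W <- enum_fset (V k)].
pose EH := EH1 ++ [seq (a * b^-1)%g | a <- EH1, b <- EH1].
have [YH [actH [YH_gt0 actHV badH]]] := sofH EH n.*2.
pose O := (V k * YH)%type.
pose step g (p : O) := l g (rep (fsval p.1)).
pose act g (p : O) : option O := obind (fun O' : V k =>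
   omap (pair O') (actH (kap (step g p)) p.2)) (insub (orb (step g p))).
exists O, act; split.
- by rewrite card_prod muln_gt0 YH_gt0 -cardfE V_gt0.
- move=> g [u u'] [v v']; rewrite /act /step /=.
  case: insubP => // O' O'V O'E /=.
  case aE : (actH _ _) => [w|] //= [eO ew]; rewrite -eO -ew in aE *.
  rewrite O'E rep_orb -lrC lVK orb_r kap_r kap_rep ?fsvalP // mul1g.
  rewrite (repV (fsvalP u)) valK /=; by rewrite (actHV _ _ _ aE).
pose bad1 := [set o : V k | has (fun g => fsval o \in D k g) E].
pose bad2 := [set v | ~~ `[< good_point EH actH v >]].
have bad1_le : (#|bad1| * n.*2 <= #|` V k|)%N.
  apply: leq_trans hk; rewrite -big_distrl leq_mul2r; apply/orP; right.
  rewrite /bad1; elim: (E) => [|g E0 IH].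
    by rewrite big_nil leqn0 cards_eq0; apply/eqP/setP => o; rewrite !inE.
  rewrite big_cons.
  have -> : [set o : V k | has (fun g => fsval o \in D k g) (g :: E0)] =
     [set o : V k | fsval o \in D k g] :|: [set o | has (fun g => fsval o \in D k g) E0].
    by apply/finset.setP => o; rewrite finset.in_setU !finset.in_set.
  rewrite (leq_trans (leq_card_setU _ _)) // leq_add //.
  rewrite cardE -(size_map val); apply: uniq_leq_size.
    by rewrite map_inj_uniq ?enum_uniq //; exact: val_inj.
  by move=> _ /mapP[w + ->]; rewrite mem_enum finset.in_set.
have sub : [set v | ~~ `[< good_point E act v >]]
    \subset finset.setX bad1 [set: YH] :|: finset.setX [set: V k] bad2.
  apply/fintype.subsetP => -[u v].
  rewrite finset.in_setU !finset.in_setX !finset.in_set /= andbT; apply: contraR.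
  rewrite negb_or => /andP[/hasPn u1]; rewrite negbK => /asboolP [beta [b1 binj bM]].
  apply/asboolP; pose x := rep (fsval u).
  have xE g : g \in E -> orb (l g x) \in V k.
    move=> gE; apply/Xorb; apply: contrapT => nx; have /negP := u1 _ gE; apply.
    by apply/inD; split=> //; exact: fsvalP.
  exists (fun g => (insubd u (orb (l g x)), beta (kap (l g x)))); split.
  - rewrite l1 (repV (fsvalP u)) (kap_rep _ (fsvalP u)) b1; congr pair.
    by apply: val_inj; rewrite val_insubd fsvalP.
  - move=> g h gE hE [] /(congr1 val).
    rewrite !val_insubd !xE // => e1 /binj e2; apply: (@l_free _ _ x).
    rewrite (kapP (l g x)) (kapP (l h x)) e1 e2 //.
      rewrite mem_cat; apply/orP; left.
      by apply/allpairsP; exists (g, fsval u); split=> //; exact: fsvalP.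
    rewrite mem_cat; apply/orP; left.
    by apply/allpairsP; exists (h, fsval u); split=> //; exact: fsvalP.
  - move=> g h gE hE ghE; rewrite /act /step /= val_insubd xE //.
    rewrite rep_orb -lrC -lM orb_r kap_r.
    have EH1P a : a \in E -> kap (l a x) \in EH1.
      by move=> aE; apply/allpairsP; exists (a, fsval u); split=> //; exact: fsvalP.
    have EHP a : a \in E -> kap (l a x) \in EH by move=> aE; rewrite mem_cat EH1P.
    rewrite insubT ?xE //= => ghV; rewrite bM ?EHP //=; last 2 first.
    - rewrite mem_cat; apply/orP; right; apply/allpairsP.
      by exists (kap (l (g * h)%g x), kap (l h x)); split=> //; exact: EH1P.
    - by rewrite -mulgA mulVg mulg1 EHP.
    rewrite -mulgA mulVg mulg1; congr (Some (_, _)).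
    by apply: val_inj; rewrite /= val_insubd xE.
have := leq_trans (subset_leq_card sub) (leq_card_setU _ _).
rewrite !finset.cardsX !cardsT => sub_le.
rewrite card_prod -leq_double doubleMr.
have bad2_le : (#|bad2| * n.*2 <= #|YH|)%N by [].
have {}bad1_le : (#|bad1| * n.*2 <= #|{: V k}|)%N by rewrite -cardfE.
apply: (leq_trans (leq_mul sub_le (leqnn n.*2))).
rewrite -[leqRHS]addnn mulnDl; apply: leq_add; first by rewrite mulnAC leq_mul.
by rewrite -mulnA leq_mul.
Qed.

End Rep.

Lemma extension_sofic : sofic H -> sofic G.
Proof.
by have [rep rp] := repP; have [kap kapP] := coordP rp; apply: extension_sofic_rep rp kapP.
Qed.
End AmenableExtension.

Lemma sofic_amenable_extension (R : realType) (H G : groupType)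
    (f : {multiplicative H -> G}) :
  sofic H -> generalized_amenable_extension R f -> sofic G.
Proof.
move=> sofH [_ [S [X [l [r [Xs [Sgen [lf rf] lrC [Xr _ _ Xn0 Xfin] lim]]]]]]].
have [x0 _] := Xn0 0%N.
apply: (extension_sofic lf rf lrC x0 Xr Xn0 Xfin Sgen) sofH => n.
have V_gt0 k : (0 < card_orbits r (Xs k))%N.
  have [x xk] := Xn0 k; rewrite cardfs_gt0; apply/fset0Pn.
  by exists [set r x h | h in [set: H]]%classic; rewrite in_fset_set // inE; exists x.
have /cvgrPdist_le /(_ n.+1%:R^-1) := lim.
rewrite invr_gt0 ltr0n => /(_ isT) [k0 _ hk0].
exists k0 => k /hk0; rewrite sub0r normrN ger0_norm ?divr_ge0 //.
rewrite ler_pdivrMr ?ltr0n // ler_pdivlMl ?ltr0n // -natrM ler_nat.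
by apply: leq_trans; rewrite mulnC leq_mul.
Qed.

(** * Direct and inverse limits *)

Lemma multiplicative1 (G H : groupType) (f : {multiplicative G -> H}) : f 1%g = 1%g.
Proof. by apply: (mulgI (f 1%g)); rewrite -gmulfM !mulg1. Qed.

Section DirectLimit.
Local Open Scope quotient_scope.
Variables (disp : Order.disp_t) (I : porderType disp) (Gs : I -> groupType)
  (f : forall i j, (i < j)%O -> {multiplicative Gs i -> Gs j}).
Hypotheses (dirI : directed I) (fsys : direct_system f).

Let T := {i : I & Gs i}.

(** The universal property of a direct limit says which elements are identified
only through homomorphisms to other groups, so the usual limit, the group of
germs of elements of the system, has to be constructed. *)
Definition germ_eq (t u : T) : bool :=
  `[< exists k (ik : (tag t < k)%O) (jk : (tag u < k)%O),
        f ik (tagged t) = f jk (tagged u) >].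

Let germ_refl : reflexive germ_eq.
Proof. by move=> t; apply/asboolP; have [k ik _] := dirI (tag t) (tag t); exists k, ik, ik. Qed.

Let germ_sym : symmetric germ_eq.
Proof. by move=> t u; apply/asboolP/asboolP => -[k [ik [jk e]]]; exists k, jk, ik. Qed.

Let germ_trans : transitive germ_eq.
Proof.
move=> u t v /asboolP[k [tk [uk e]]] /asboolP[m [um [vm e']]]; apply/asboolP.
have [n kn mn] := dirI k m.
exists n, (lt_trans tk kn), (lt_trans vm mn).
rewrite -(fsys tk kn) -(fsys vm mn) e -e' (fsys uk kn (lt_trans uk kn)).
by rewrite (fsys um mn (lt_trans uk kn)).
Qed.

Definition germ_equiv : equiv_rel T := EquivRel germ_eq germ_refl germ_sym germ_trans.
Definition germs := {eq_quot germ_equiv}.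
HB.instance Definition _ := Choice.on germs.

Definition germ i (x : Gs i) : germs := \pi_(germs) (existT (fun i => Gs i : Type) i x).

Let germP i (x : Gs i) j (y : Gs j) :
  germ x = germ y <-> exists k (ik : (i < k)%O) (jk : (j < k)%O), f ik x = f jk y.
Proof.
split; first by move/eqmodP/asboolP.
by move=> e; apply/eqmodP/asboolP.
Qed.

Let germ_f i j (ij : (i < j)%O) (x : Gs i) : germ (f ij x) = germ x.
Proof.
apply/germP; have [k ik jk] := dirI i j; exists k, jk, ik; exact: fsys.
Qed.

Let germ_rep (q : germs) : exists i (x : Gs i), q = germ x.
Proof. by elim/quotW: q => -[i x]; exists i, x. Qed.

Let germ_rep2 (q q' : germs) : exists (t : {i : I & (Gs i * Gs i)%type}),
  q = germ (tagged t).1 /\ q' = germ (tagged t).2.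
Proof.
have [i [x ->]] := germ_rep q; have [j [y ->]] := germ_rep q'.
have [k ik jk] := dirI i j; exists (existT (fun i => (Gs i * Gs i)%type) k (f ik x, f jk y)).
by rewrite /= !germ_f.
Qed.

Let germ_wd i (x y : Gs i) j (x' y' : Gs j) :
  germ x = germ x' -> germ y = germ y' -> germ (x * y)%g = germ (x' * y')%g.
Proof.
move=> /germP[k [ik [jk e]]] /germP[m [im [jm e']]]; have [n kn mn] := dirI k m.
apply/germP; exists n, (lt_trans ik kn), (lt_trans jk kn).
rewrite !gmulfM -!(fsys ik kn) -!(fsys jk kn) e; congr (_ * _)%g.
have := congr1 (f mn) e'; rewrite (fsys im mn (lt_trans ik kn)) (fsys jm mn (lt_trans jk kn)).
by rewrite (fsys ik kn (lt_trans ik kn)) (fsys jk kn (lt_trans jk kn)).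
Qed.

Let germ_wdV i (x : Gs i) j (x' : Gs j) :
  germ x = germ x' -> germ x^-1%g = germ x'^-1%g.
Proof.
move=> /germP[k [ik [jk e]]]; apply/germP; exists k, ik, jk.
have fV a (ak : (a < k)%O) (z : Gs a) : f ak z^-1%g = (f ak z)^-1%g.
  by apply: (mulgI (f ak z)); rewrite -gmulfM !mulgV multiplicative1.
by rewrite !fV e.
Qed.

Variable i0 : I.

Definition germ_mul (q q' : germs) : germs :=
  let t := projT1 (cid (germ_rep2 q q')) in germ ((tagged t).1 * (tagged t).2)%g.
Definition germ_inv (q : germs) : germs :=
  let t := projT1 (cid (germ_rep2 q q)) in germ (tagged t).1^-1%g.
Definition germ_one : germs := germ (1%g : Gs i0).

Let germM i (x y : Gs i) : germ_mul (germ x) (germ y) = germ (x * y)%g.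
Proof. by rewrite /germ_mul; case: cid => t /= [e e']; apply: germ_wd. Qed.
Let germV i (x : Gs i) : germ_inv (germ x) = germ x^-1%g.
Proof. by rewrite /germ_inv; case: cid => t /= [e _]; apply: germ_wdV. Qed.
Let germ1 i : germ_one = germ (1%g : Gs i).
Proof.
apply/germP; have [k ik jk] := dirI i0 i; exists k, ik, jk.
by rewrite !multiplicative1.
Qed.

Let germ_mulA : associative germ_mul.
Proof.
move=> p q s; have [[i [x y]] /= [-> ->]] := germ_rep2 p q.
have [j [z ->]] := germ_rep s; have [k ik jk] := dirI i j.
by rewrite -(germ_f ik x) -(germ_f ik y) -(germ_f jk z) !germM mulgA.
Qed.
Let germ_mul1 : left_id germ_one germ_mul.
Proof. by move=> q; have [i [x ->]] := germ_rep q; rewrite (germ1 i) germM mul1g. Qed.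
Let germ_1mul : right_id germ_one germ_mul.
Proof. by move=> q; have [i [x ->]] := germ_rep q; rewrite (germ1 i) germM mulg1. Qed.
Let germ_mulV : left_inverse germ_one germ_inv germ_mul.
Proof. by move=> q; have [i [x ->]] := germ_rep q; rewrite (germ1 i) germV germM mulVg. Qed.
Let germ_Vmul : right_inverse germ_one germ_inv germ_mul.
Proof. by move=> q; have [i [x ->]] := germ_rep q; rewrite (germ1 i) germV germM mulgV. Qed.

Definition germ_group : groupType :=
  HB.pack germs (isGroup.Build germs germ_mulA germ_mul1 germ_1mul germ_mulV germ_Vmul).
Definition germ_hom i : {multiplicative Gs i -> germ_group} :=
  HB.pack (@germ i : Gs i -> germ_group) (isMultiplicative.Build _ germ_group (@germ i) (fun x y => esym (germM x y))).

Variables (G : groupType) (phi : forall i, {multiplicative Gs i -> G}).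
Hypothesis limG : is_direct_limit f phi.

(** The group of germs is a cocone, and two elements with the same germ agree at a
later stage of the system. *)
Lemma direct_limit_eq i (x y : Gs i) : phi i x = phi i y ->
  exists k (ik : (i < k)%O), f ik x = f ik y.
Proof.
move=> e; have [_ /(_ germ_group germ_hom)] := limG.
case=> [a b ab z|u uE _]; first exact: germ_f.
have : germ_hom i x = germ_hom i y by rewrite -!uE e.
by move/germP => [k [ik [ik' ee]]]; exists k, ik; rewrite ee (bool_irrelevance ik ik').
Qed.
End DirectLimit.

Section SubgroupType.
Variables (G : groupType) (K : set G) (hK : is_subgroup K).
Definition subgroup_type := {x : G | `[< K x >]}.
HB.instance Definition _ := Choice.on subgroup_type.
Let K1 : `[< K 1%g >]. Proof. by apply/asboolP; case: hK. Qed.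
Let KM (x y : subgroup_type) : `[< K (val x * val y)%g >].
Proof. have [_ h _] := hK; apply/asboolP; by apply: h; [exact: asboolW (proj2_sig x)|exact: asboolW (proj2_sig y)]. Qed.
Let KV (x : subgroup_type) : `[< K (val x)^-1%g >].
Proof. have [_ _ h] := hK; apply/asboolP; by apply: h; exact: asboolW (proj2_sig x). Qed.
Let one : subgroup_type := exist (fun z => `[< K z >]) _ K1.
Let mul (x y : subgroup_type) : subgroup_type := exist (fun z => `[< K z >]) _ (KM x y).
Let inv (x : subgroup_type) : subgroup_type := exist (fun z => `[< K z >]) _ (KV x).
Let mulA : associative mul. Proof. by move=> x y z; apply: val_inj; rewrite /= mulgA. Qed.
Let mul1 : left_id one mul. Proof. by move=> x; apply: val_inj; rewrite /= mul1g. Qed.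
Let mulr1 : right_id one mul. Proof. by move=> x; apply: val_inj; rewrite /= mulg1. Qed.
Let mulV : left_inverse one inv mul. Proof. by move=> x; apply: val_inj; rewrite /= mulVg. Qed.
Let mulrV : right_inverse one inv mul. Proof. by move=> x; apply: val_inj; rewrite /= mulgV. Qed.
Definition subgroup_group : groupType :=
  HB.pack subgroup_type (isGroup.Build subgroup_type mulA mul1 mulr1 mulV mulrV).
Definition subgroup_incl : {multiplicative subgroup_group -> G} :=
  HB.pack (fun x : subgroup_group => val (x : subgroup_type))
   (isMultiplicative.Build subgroup_group G (fun x : subgroup_group => val (x : subgroup_type)) (fun x y => erefl)).
Lemma subgroup_inclP (x : subgroup_group) : K (subgroup_incl x).
Proof. by exact: asboolW (proj2_sig (x : subgroup_type)). Qed.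
Lemma subgroup_incl_lift x : K x -> exists y, subgroup_incl y = x.
Proof. by move=> Kx; have h := asboolT Kx; exists (exist (fun z => `[< K z >]) x h). Qed.
End SubgroupType.

Definition trivial_hom (G H : groupType) : {multiplicative G -> H} :=
  HB.pack (fun _ : G => 1%g : H)
    (isMultiplicative.Build G H (fun _ => 1%g) (fun _ _ => esym (mulg1 1%g))).

Section LimitSofic.
Variables (disp : Order.disp_t) (I : porderType disp) (Gs : I -> groupType).

(** A finite part of a direct limit lifts to a late stage of the system, where the
finitely many relations between the lifts hold. *)
Lemma sofic_direct_limit
    (f : forall i j, (i < j)%O -> {multiplicative Gs i -> Gs j})
    (G : groupType) (phi : forall i, {multiplicative Gs i -> G}) :
  directed I -> direct_system f -> (forall i, sofic (Gs i)) ->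
  is_direct_limit f phi -> sofic G.
Proof.
move=> dirI fsys sofGs limG; have [phif univ] := limG.
have uniq_end (v w : {multiplicative G -> G}) :
    (forall i x, v (phi i x) = phi i x) -> (forall i x, w (phi i x) = phi i x) -> v =1 w.
  move=> vP wP; have [u _ uu] := univ G phi phif.
  by move=> x; rewrite (uu v vP) (uu w wP).
have [i0|noI] := pselect (inhabited I); last first.
  apply: sofic_trivial => x; apply: (uniq_end idfun (trivial_hom G G)) => i;
    by case: noI.
case: i0 => i0.
pose K : set G := [set g | exists i (x : Gs i), phi i x = g]%classic.
have phiV i (x : Gs i) : phi i x^-1%g = (phi i x)^-1%g.
  by apply: (mulgI (phi i x)); rewrite -gmulfM !mulgV multiplicative1.
have hK : is_subgroup K.
  split; first by exists i0, 1%g; rewrite multiplicative1.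
  - move=> _ _ [i [x <-]] [j [y <-]]; have [k ik jk] := dirI i j.
    by exists k, (f i k ik x * f j k jk y)%g; rewrite gmulfM !phif.
  - by move=> _ [i [x <-]]; exists i, x^-1%g.
have surj g : K g.
  (* The union of the images of the stages is a subgroup to which the cocone
     restricts; by uniqueness, the limit maps into it by the identity. *)
  have phiK i (x : Gs i) : `[< K (phi i x) >] by apply/asboolP; exists i, x.
  pose psi0 i (x : Gs i) : subgroup_group hK := exist (fun z => `[< K z >]) _ (phiK i x).
  have psiM i : {morph psi0 i : x y / (x * y)%g >-> (x * y)%g}.
    by move=> x y; apply: val_inj; rewrite /= gmulfM.
  pose psi i : {multiplicative Gs i -> subgroup_group hK} :=
    HB.pack (psi0 i) (isMultiplicative.Build _ (subgroup_group hK) (psi0 i) (psiM i)).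
  have [|u uE _] := univ _ psi.
    by move=> i j ij x; apply: val_inj; rewrite /= phif.
  pose v : {multiplicative G -> G} := subgroup_incl hK \o u.
  have <- : v g = g.
    by apply: (uniq_end v idfun) => // i x; rewrite /v /= uE.
  exact: subgroup_inclP.
apply: sofic_local => E.
have [k [lift liftP]] : exists k (lift : G -> Gs k), forall x, x \in E -> phi k (lift x) = x.
  elim: E => [|x E [k [lift liftP]]]; first by exists i0, (fun _ => 1%g).
  have [i [y yE]] := surj x; have [m im km] := dirI i k.
  exists m, (fun z => if z == x then f i m im y else f k m km (lift z)) => z.
  rewrite inE; case: eqVneq => [-> _|_ /= zE]; first by rewrite phif.
  by rewrite phif liftP.
have lim_eq (s : seq (Gs k * Gs k)) :
    (forall p, p \in s -> phi k p.1 = phi k p.2) ->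
    exists m (km : (k < m)%O), forall p, p \in s -> f k m km p.1 = f k m km p.2.
  elim: s => [_|p s IH sP].
    by have [m km _] := dirI k k; exists m, km.
  have [|m [km mP]] := IH; first by move=> q qs; apply: sP; rewrite inE qs orbT.
  have [|n [kn nP]] := direct_limit_eq dirI fsys i0 limG (x := p.1) (y := p.2).
    by apply: sP; rewrite inE eqxx.
  have [t mt nt] := dirI m n; exists t, (lt_trans km mt) => q.
  rewrite inE => /orP[/eqP ->|/mP qE].
    by rewrite -!(fsys _ _ _ kn nt) nP.
  by rewrite -!(fsys _ _ _ km mt) qE.
pose s := [seq (lift (p.1 * p.2)%g, (lift p.1 * lift p.2)%g)
  | p <- [seq (x, y) | x <- E, y <- E] & (p.1 * p.2)%g \in E].
have [|m [km mP]] := lim_eq s.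
  move=> q /mapP[p]; rewrite mem_filter => /andP[pE /allpairsP[[x y] /= [xE yE e]]] ->.
  by rewrite e /= in pE *; rewrite gmulfM !liftP.
exists (Gs m); split=> //; exists (fun x => f k m km (lift x)); split.
- move=> x y xE yE /(congr1 (phi m)); by rewrite !phif !liftP.
- move=> x y xE yE xyE; rewrite -gmulfM.
  apply: (mP (lift (x * y)%g, (lift x * lift y)%g)).
  apply/mapP; exists (x, y) => //; rewrite mem_filter xyE.
  by apply/allpairsP; exists (x, y).
Qed.

(** The projections of an inverse limit separate its points, so one of them is
injective on a given finite part. *)
Lemma sofic_inverse_limit
    (f : forall i j, (i < j)%O -> {multiplicative Gs j -> Gs i})
    (G : groupType) (phi : forall i, {multiplicative G -> Gs i}) :
  directed I -> (forall i, sofic (Gs i)) -> is_inverse_limit f phi -> sofic G.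
Proof.
move=> dirI sofGs [phif univ].
pose K : set G := [set g | forall i, phi i g = 1%g]%classic.
have hK : is_subgroup K.
  split=> [i|x y xK yK i|x xK i]; rewrite ?multiplicative1 //.
    by rewrite gmulfM xK yK mulg1.
  by apply: (mulgI (phi i x)); rewrite -gmulfM !mulgV multiplicative1 xK mulg1.
have K_trivial g : K g -> g = 1%g.
  move=> /(subgroup_incl_lift hK) [y <-].
  have [|u _ uu] := univ _ (fun i => trivial_hom (subgroup_group hK) (Gs i)).
    by move=> i j ij x /=; rewrite multiplicative1.
  have -> : 1%g = trivial_hom (subgroup_group hK) G y by [].
  rewrite !uu // => i x /=; first by rewrite multiplicative1.
  exact: (subgroup_inclP x i).
have [i0|noI] := pselect (inhabited I); last first.
  by apply: sofic_trivial => x; apply: K_trivial => i; case: noI.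
case: i0 => i0; apply: sofic_local => E.
have [k kP] : exists k, forall z, z \in [seq (x * y^-1)%g | x <- E, y <- E] ->
    z != 1%g -> phi k z != 1%g.
  elim: [seq _ | x <- E, y <- E] => [|z s [k kP]]; first by exists i0.
  have [z1|z1] := eqVneq z 1%g.
    exists k => w; rewrite inE => /orP[/eqP -> /negP|]; last exact: kP.
    by rewrite z1 eqxx => /(_ isT).
  have [i iP] : exists i, phi i z != 1%g.
    apply: contrapT => nz; move/eqP: z1; apply; apply: K_trivial => i.
    by apply/eqP; apply: contrapT => /negP iz; apply: nz; exists i.
  have [m im km] := dirI i k; exists m => w; rewrite inE => /orP[/eqP -> _|ws w1].
    by apply: contra iP => /eqP e; rewrite -(phif _ _ im) e multiplicative1.
  by have := kP w ws w1; apply: contra => /eqP e; rewrite -(phif _ _ km) e multiplicative1.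
exists (Gs k); split=> //; exists (phi k); split; last by move=> *; rewrite gmulfM.
move=> x y xE yE e; apply/eqP; apply: contrapT => /negP xy.
have : (x * y^-1)%g \in [seq (x * y^-1)%g | x <- E, y <- E].
  by apply/allpairsP; exists (x, y).
move/kP.
have phiV z : phi k z^-1%g = (phi k z)^-1%g.
  by apply: (mulgI (phi k z)); rewrite -gmulfM !mulgV multiplicative1.
rewrite gmulfM phiV e mulgV eqxx => h.
suff /h : (x * y^-1)%g != 1%g by [].
apply: contra xy => /eqP xy1; apply/eqP.
by rewrite -[x]mulg1 -(mulVg y) mulgA xy1 mul1g.
Qed.
End LimitSofic.

Theorem classG_sofic (R : realType) (G : groupType) : classG R G -> sofic G.
Proof.
elim=> {G}.
- exact: sofic_trivial.
- by move=> H G f _; apply: sofic_amenable_extension.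
- move=> U H f _ sofH finj; apply: sofic_local => E; exists H; split=> //.
  by exists f; split=> [x y _ _ /finj|x y _ _ _]; rewrite ?gmulfM.
- by move=> disp I Gs f G phi dirI fsys _ sofGs; apply: sofic_direct_limit.
- by move=> disp I Gs f G phi dirI fsys _ sofGs; apply: sofic_inverse_limit.
Qed.

(** * Norms of algebraic integers *)

Lemma prod_const_seq (R : pzSemiRingType) (T : Type) (x : R) (s : seq T) :
  \prod_(t <- s) x = x ^+ size s.
Proof. by rewrite big_const_seq count_predT iter_mulr_1. Qed.

(** Both sides are the resultant of [char_poly A] and [q]: factor [q], and note
that [A - r] has determinant [char_poly A].[r] up to sign. *)
Lemma det_horner_mx (C : closedFieldType) n (A : 'M[C]_n.+1) (q : {poly C}) (s : seq C) :
  char_poly A = \prod_(t <- s) ('X - t%:P) ->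
  \det (horner_mx A q) = \prod_(t <- s) q.[t].
Proof.
move=> As; have sz : size s = n.+1.
  by apply: succn_inj; rewrite -(size_prod_XsubC s id) -As size_char_poly.
have [rs ->] := closed_field_poly_normal q.
have -> : horner_mx A (lead_coef q *: \prod_(r <- rs) ('X - r%:P)) =
    lead_coef q *: \prod_(r <- rs) (A - r%:M).
  rewrite linearZ rmorph_prod /=; congr (_ *: _); apply: eq_bigr => r _.
  by rewrite rmorphB /= horner_mx_X horner_mx_C.
have detr r : \det (A - r%:M) = \prod_(t <- s) (t - r).
  have -> : A - r%:M = - (r%:M - A) by rewrite opprB.
  have -> : r%:M - A = map_mx (horner_eval r) (char_poly_mx A).
    by apply/matrixP => i j; rewrite !mxE /horner_eval !hornerE hornerMn hornerX.
  rewrite -scaleN1r detZ det_map_mx /= -/(char_poly A) As /horner_eval horner_prod.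
  rewrite -sz -(prod_const_seq _ s) -big_split /=.
  by apply: eq_bigr => t _; rewrite !hornerE mulN1r opprB.
rewrite detZ.
have -> : \det (\prod_(r <- rs) (A - r%:M)) = \prod_(r <- rs) \det (A - r%:M).
  elim: rs {As detr} => [|r rs IH]; first by rewrite !big_nil det1.
  by rewrite !big_cons -IH; exact: det_mulmx.
under [RHS]eq_bigr => t _.
  rewrite hornerZ horner_prod.
  under eq_bigr do rewrite hornerXsubC.
  over.
rewrite big_split /= prod_const_seq sz exchange_big /=.
by congr (_ * _); apply: eq_bigr => r _.
Qed.

Lemma coef_comp_scaleX (R : comNzRingType) (p : {poly R}) (a : R) i :
  (p \Po (a *: 'X))`_i = p`_i * a ^+ i.
Proof.
rewrite comp_polyE; under eq_bigr do rewrite exprZn scalerA.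
rewrite -(poly_def _ (fun i => p`_i * a ^+ i)) coef_poly; case: ltnP => // h.
by rewrite nth_default ?mul0r.
Qed.

Section Norm.
Variable C : numClosedFieldType.
Local Notation toC := (map_poly (intr : int -> C)).

(** The norm of [c] is the determinant of the integer matrix obtained by applying
[c] to a companion matrix. *)
Lemma prod_conjugates_int (P c : {poly int}) (s : seq C) :
  P \is monic -> toC P = \prod_(t <- s) ('X - t%:P) ->
  exists z : int, z%:~R = \prod_(t <- s) (toC c).[t].
Proof.
move=> Pmon Ps; have [M MP] : exists M : 'M[int]_((size P).-1), char_poly M = P.
  by exists (companionmx P); apply: companionmxK.
case E : (size P).-1 M MP => [|n] M MP.
  exists 1; have : size (toC P) = (size s).+1 by rewrite Ps size_prod_XsubC.
  rewrite size_map_poly_id0 ?intr_eq0 ?lead_coef_eq0 ?monic_neq0 // => sz.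
  by move: E; rewrite sz /=; case: (s) => // _; rewrite big_nil.
exists (\det (horner_mx M c)).
rewrite -(@det_horner_mx _ _ (map_mx intr M)) -?map_horner_mx ?det_map_mx //.
by rewrite -map_char_poly MP.
Qed.

(** If [l] is the leading coefficient of an integer multiple of the minimal
polynomial of [theta], then [l theta] is an algebraic integer.  By minimality, a
polynomial that does not vanish at [theta] is coprime to the minimal polynomial,
hence does not vanish at the other conjugates either. *)
Lemma integral_conjugates (theta : C) :
  algebraicOver (ratr : rat -> C) theta ->
  exists (D : int) (P : {poly int}) (s : seq C),
    [/\ D != 0, P \is monic, toC P = \prod_(t <- D%:~R * theta :: s) ('X - t%:P)
      & forall c : {poly int}, (toC c).[D%:~R * theta] != 0 ->
          {in s, forall t, (toC c).[t] != 0}].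
Proof.
move=> alg.
have ex : exists n, `[< exists p : {poly rat}, [/\ p != 0, root (map_poly ratr p) theta & size p = n] >].
  by have [p p0 rp] := alg; exists (size p); apply/asboolP; exists p.
case: (ex_minnP ex) => n /asboolP[p [p0 rp szp]] minp.
have copr (q : {poly rat}) : (map_poly ratr q).[theta] != 0 -> coprimep p q.
  move=> q0; pose h := p %/ gcdp p q.
  have pE : p = h * gcdp p q by rewrite divpK // dvdp_gcdl.
  have g0 : gcdp p q != 0 by apply: contraNneq p0 => g0; rewrite pE g0 mulr0.
  have h0 : h != 0 by apply: contraNneq p0 => h0; rewrite pE h0 mul0r.
  have gth : ~~ root (map_poly ratr (gcdp p q)) theta.
    apply: contra q0 => /rootP gth; have [k ->] := dvdpP _ _ (dvdp_gcdr p q).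
    by rewrite rmorphM hornerM gth mulr0.
  have rh : root (map_poly ratr h) theta.
    by move: rp; rewrite pE rmorphM rootM (negPf gth) orbF.
  have : (n <= size h)%N by apply: minp; apply/asboolP; exists h.
  have szE := congr1 (size \o val) pE; rewrite /= size_mul // in szE.
  rewrite -szp szE /coprimep; have := size_poly_gt0 (gcdp p q); rewrite g0.
  case: (size (gcdp p q)) => [|[|k]] // _.
  by rewrite !addnS /= ltnNge leq_addr.
have [q [a a0 pq]] := rat_poly_scale p.
have qE : map_poly (ratr : rat -> C) p = a%:~R^-1 *: toC q.
  rewrite pq linearZ /= fmorphV rmorph_int -map_poly_comp.
  by congr (_ *: _); apply: eq_map_poly => z; rewrite /= ratr_int.
have q0 : q != 0 by apply: contraNneq p0 => q0; rewrite pq q0 rmorph0 scaler0.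
have rq : root (toC q) theta by move: rp; rewrite qE rootZ // invr_eq0 intr_eq0.
pose l := lead_coef q; have l0 : l != 0 by rewrite lead_coef_eq0.
have lC0 : (l%:~R : C) != 0 by rewrite intr_eq0.
have szC : size (toC q) = size q by apply: size_map_inj_poly => //; exact: intr_inj.
have qC0 : toC q != 0 by rewrite -size_poly_eq0 szC size_poly_eq0.
have [rs rsE] := closed_field_poly_normal (toC q).
have th_rs : theta \in rs.
  by move: rq; rewrite rsE rootZ ?root_prod_XsubC // lead_coef_eq0.
have sz1 : (1 < size q)%N.
  by rewrite -szC; apply: (root_size_gt1 _ rq).
have [m szq] : exists m, size q = m.+2 by case: (size q) sz1 => [|[|m]] // _; exists m.
pose P : {poly int} := 'X^(m.+1) + \poly_(i < m.+1) (q`_i * l ^+ (m - i)).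
have Pmon : P \is monic.
  by apply/monicP; rewrite lead_coefDl ?lead_coefXn // size_polyXn ltnS size_poly.
have Pscale : toC P \Po (l%:~R *: 'X) = l%:~R ^+ m *: toC q.
  apply/polyP => i; rewrite coef_comp_scaleX coefZ !coef_map_id0 //.
  rewrite coefD coefXn coef_poly; case: (ltngtP i m.+1) => [im|im|->].
  - rewrite add0r rmorphM rmorphXn /= -mulrA -exprD subnK // mulrC; by [].
  - by rewrite (nth_default _ (s := q)) ?szq // addr0 !mulr0n mul0r mulr0.
  - have -> : q`_m.+1 = l by rewrite /l lead_coefE szq.
    by rewrite addr0 mul1r exprSr.
have lead_q : lead_coef (toC q) = l%:~R by rewrite lead_coef_map_inj //; exact: intr_inj.
have sz_rs : size rs = m.+1.
  have := szC; rewrite rsE lead_q size_scale // (size_prod_XsubC rs id) szq.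
  by case.
have scaleXK : (l%:~R *: 'X : {poly C}) \Po (l%:~R^-1 *: 'X) = 'X.
  by rewrite comp_polyZ comp_polyX scalerA divff ?scale1r.
have PE : toC P = \prod_(t <- [seq l%:~R * t | t <- rs]) ('X - t%:P).
  rewrite -[LHS]comp_polyXr -scaleXK comp_polyA Pscale rsE lead_q scalerA -exprSr.
  rewrite comp_polyZ rmorph_prod /= -sz_rs big_map; elim: (rs) => [|t ts IH].
    by rewrite !big_nil scale1r.
  rewrite !big_cons -IH exprS comp_polyB comp_polyX comp_polyC.
  rewrite -scalerA scalerAr scalerAl; congr (_ * _).
  by rewrite scalerBr scalerA divff // scale1r -mul_polyC -polyCM scaleXK.
exists l, P, [seq l%:~R * t | t <- rem theta rs]; split=> //.
  rewrite PE; apply: perm_big; rewrite -map_cons; exact/perm_map/perm_to_rem.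
move=> c c0 _ /mapP[t trs ->].
pose c' : {poly rat} := map_poly intr c \Po (l%:~R *: 'X).
have c'E x : (map_poly (ratr : rat -> C) c').[x] = (toC c).[l%:~R * x].
  rewrite map_comp_poly linearZ /= map_polyX rmorph_int horner_comp hornerZ hornerX.
  by rewrite -map_poly_comp; congr (_.[_]); apply: eq_map_poly => z; rewrite /= rmorph_int.
have := c0; rewrite -c'E => /copr; rewrite -(coprimep_map (ratr : {rmorphism rat -> C})).
move=> /coprimep_root h; rewrite -c'E; apply: h.
rewrite qE rootZ ?invr_eq0 ?intr_eq0 // rsE rootZ ?lead_q // root_prod_XsubC.
exact: mem_rem trs.
Qed.

Lemma simple_extension (cs : seq C) :
  {in cs, forall c, algebraicOver (ratr : rat -> C) c} ->
  exists2 theta : C, algebraicOver (ratr : rat -> C) theta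
    & {in cs, forall c, exists p : {poly rat}, (map_poly ratr p).[theta] = c}.
Proof.
elim: cs => [_|c cs IH alg]; first by exists 0 => //; apply: algebraic0.
have [|theta algt tP] := IH; first by move=> a acs; apply: alg; rewrite inE acs orbT.
have algc := alg c (mem_head _ _).
have [p p0 rp] := algt; have [q q0 rq] := algc.
have [n [[px pxE] [py pyE]]] := pchar0_PET p0 rp q0 rq (pchar_num _).
exists (c *+ n - theta).
  by apply: algebraic_sub => //; rewrite -mulr_natl -(rmorph_nat (ratr : {rmorphism rat -> C}));
    apply: algebraic_mul => //; apply: algebraic_id.
move=> a; rewrite inE => /orP[/eqP -> |/tP [f fE]]; first by exists py.
by exists (f \Po px); rewrite map_comp_poly horner_comp pxE.
Qed.

(** Finitely many algebraic numbers can be handled in the ring [Z[theta]] of a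
single algebraic integer.  All that is retained of the conjugates [s] of
[theta] is that the norm of a nonzero element is at least [1] in absolute
value. *)
Theorem conjugate_system (cs : seq C) :
  {in cs, forall c, algebraicOver (ratr : rat -> C) c} ->
  exists (N : nat) (theta : C) (s : seq C),
    [/\ (0 < N)%N,
       (forall c : {poly int}, (toC c).[theta] != 0 ->
          1 <= \prod_(t <- theta :: s) `|(toC c).[t]|)
     & {in cs, forall c, exists f : {poly int}, N%:R * c = (toC f).[theta]}].
Proof.
move=> /simple_extension [th0 /integral_conjugates [D [P [s [D0 Pmon PE cop]]]] rep].
suff [N N0 repN] : exists2 N : nat, (0 < N)%N & {in cs, forall c,
    exists f : {poly int}, N%:R * c = (toC f).[D%:~R * th0]}.
  exists N, (D%:~R * th0), s; split=> // c c0.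
  have [z zE] := prod_conjugates_int c Pmon PE.
  rewrite -normr_prod -zE -intr_norm -[1]/(1%:~R) ler_int -gtz0_ge1 normr_gt0.
  rewrite -(intr_eq0 C) zE big_cons mulf_neq0 //.
  by rewrite prodf_seq_neq0; apply/allP => t /(cop _ c0).
elim: cs rep => [_|c cs IH rep]; first by exists 1%N.
have [|N N0 NP] := IH; first by move=> a acs; apply: rep; rewrite inE acs orbT.
have [p pE] := rep c (mem_head _ _).
have [q [a a0 pq]] := rat_poly_scale (p \Po (D%:~R^-1 *: 'X)).
have DC0 : (D%:~R : C) != 0 by rewrite intr_eq0.
have cE : a%:~R * c = (toC q).[D%:~R * th0].
  have -> : c = (map_poly (ratr : rat -> C) (p \Po (D%:~R^-1 *: 'X))).[D%:~R * th0].
    rewrite map_comp_poly linearZ /= map_polyX fmorphV rmorph_int horner_comp.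
    by rewrite hornerZ hornerX mulKf.
  rewrite pq linearZ /= fmorphV rmorph_int hornerZ mulVKf ?intr_eq0 //.
  by rewrite -map_poly_comp; congr (_.[_]); apply: eq_map_poly => z; rewrite /= rmorph_int.
have mapM (u v : {poly int}) : toC (u * v) = toC u * toC v by exact: rmorphM.
exists (N * `|a|)%N; first by rewrite muln_gt0 N0 absz_gt0.
move=> b; rewrite inE => /orP[/eqP ->|/NP [f fE]].
  exists ((N%:R * sgz a)%:P * q); rewrite mapM hornerM /= map_polyC hornerC -cE /= natrM rmorphM /= rmorph_nat.
  by rewrite -!mulrA; congr (_ * _); rewrite mulrA -intrM -abszEsg.
exists ((`|a|%N%:R)%:P * f).
by rewrite mapM hornerM /= map_polyC hornerC -fE /= natrM rmorph_nat mulrCA mulrA.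
Qed.
End Norm.

(** * Small eigenvalues of Hermitian matrices over a ring of algebraic integers *)

(** Sum the absolute values of the entries of [v *m A = a *: v]. *)
Lemma eigenvalue_bound (C : numClosedFieldType) n (A : 'M[C]_n) (k a : C) :
  (forall i, \sum_j `|A i j| <= k) -> eigenvalue A a -> `|a| <= k.
Proof.
move=> Ak /eigenvalueP [v vA v0].
have S_gt0 : 0 < \sum_i `|v 0 i|.
  rewrite lt_def sumr_ge0 // andbT; apply: contra v0 => S0; apply/eqP/rowP => i.
  by move: S0; rewrite psumr_eq0 // => /allP /(_ i (mem_index_enum _)) /=; rewrite normr_eq0 mxE => /eqP.
rewrite -(ler_pM2r S_gt0) mulr_sumr.
apply: (@le_trans _ _ (\sum_j \sum_i `|v 0 i| * `|A i j|)).
  apply: ler_sum => j _; rewrite -normrM.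
  have -> : a * v 0 j = \sum_i v 0 i * A i j by have := congr1 (fun M : 'rV[C]_n => M 0 j) vA; rewrite !mxE => ->.
  by apply: le_trans (ler_norm_sum _ _ _) _; apply: ler_sum => i _; rewrite normrM.
rewrite exchange_big mulr_sumr; apply: ler_sum => i _ /=.
by rewrite -mulr_sumr mulrC ler_wpM2r.
Qed.

Lemma coef_prod_XsubC_bound (C : numClosedFieldType) (s : seq C) (k : C) N :
  0 <= k -> {in s, forall a, `|a| <= k} ->
  `|(\prod_(a <- s) ('X - a%:P))`_N| <= (1 + k) ^+ size s.
Proof.
move=> k0; elim: s N => [|a s IH] N sk.
  by rewrite big_nil coef1 expr0; case: (N == 0%N); rewrite ?normr1 ?normr0.
have {}IH M := IH M (fun b bs => sk b (mem_behead (s := a :: s) bs)).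
rewrite big_cons mulrBl mul_polyC coefB coefXM coefZ /= exprS mulrDl mul1r.
apply: le_trans (ler_normB _ _) _; apply: lerD.
  by case: eqP => _; rewrite ?normr0 ?exprn_ge0 ?addr_ge0.
by rewrite normrM ler_pM // sk ?mem_head.
Qed.

Lemma coef_char_poly_bound (C : numClosedFieldType) n (A : 'M[C]_n) (k : C) N :
  0 <= k -> (forall i, \sum_j `|A i j| <= k) -> `|(char_poly A)`_N| <= (1 + k) ^+ n.
Proof.
move=> k0 Ak; have [s sE] := closed_field_poly_normal (char_poly A).
rewrite (monicP (char_poly_monic A)) scale1r in sE.
have sz : size s = n.
  by apply: succn_inj; rewrite -(size_prod_XsubC s id) -sE size_char_poly.
rewrite sE -[X in _ ^+ X]sz; apply: coef_prod_XsubC_bound => // a a_s.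
by apply: eigenvalue_bound Ak _; rewrite eigenvalue_root_char sE root_prod_XsubC.
Qed.

Section Hermitian.
Variable R : realType.
Notation C := (complex R).
Notation rc := (real_complex R).

Lemma char_poly_similar n (P A : 'M[C]_n) : P \in unitmx ->
  char_poly (invmx P *m A *m P) = char_poly A.
Proof.
move=> Pu; pose Q := map_mx polyC P; pose Q' := map_mx polyC (invmx P).
have QQ : Q' *m Q = 1%:M by rewrite -map_mxM mulVmx // map_mx1.
rewrite /char_poly (_ : char_poly_mx _ = Q' *m char_poly_mx A *m Q); last first.
  by rewrite /char_poly_mx mulmxBr mulmxBl !map_mxM scalar_mxC -[_%:M *m _ *m _]mulmxA QQ mulmx1.
by rewrite !det_mulmx mulrAC -det_mulmx QQ det1 mul1r.
Qed.

(** By the spectral theorem; the traces of polynomials of [A] record the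
eigenvalues with their multiplicities. *)
Lemma hermitian_eigenvalues n (A : 'M[C]_n.+1) :
  (forall i j, A i j = (A j i)^*) ->
  exists t : 'I_n.+1 -> R,
    char_poly A = \prod_i ('X - (rc (t i))%:P) /\
    forall r : {poly R}, \tr (horner_mx A (map_poly rc r)) = rc (\sum_i r.[t i]).
Proof.
move=> Ah; have Aherm : A \is hermsymmx.
  by apply/is_hermitianmxP/matrixP => i j; rewrite expr0 scale1r !mxE.
have /orthomx_spectralP AE := hermitian_normalmx Aherm.
have Dreal := hermitian_spectral_diag_real Aherm.
have Pu := spectral_unit A.
move: AE Dreal Pu; move: (spectralmx A) (spectral_diag A) => P D AE Dreal Pu.
exists (fun i => complex.Re (D 0 i)).
have DE i : D 0 i = rc (complex.Re (D 0 i)).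
  by rewrite RRe_real //; move/mxOverP: Dreal; apply.
split.
  rewrite AE char_poly_similar // char_poly_trig ?diag_mx_is_trig //.
  by apply: eq_bigr => i _; rewrite mxE eqxx mulr1n -DE.
move=> r; rewrite [in LHS]AE.
have -> : invmx P *m diag_mx D *m P = conjmx (invmx P) (diag_mx D).
  by rewrite conjumx ?unitmx_inv // invmxK.
rewrite horner_mx_conj ?row_free_unit ?unitmx_inv ?stablemx_unit ?unitmx_inv //.
rewrite conjumx ?unitmx_inv // invmxK mxtrace_mulC mulmxA mulmxV // mul1mx.
rewrite horner_mx_diag mxtrace_diag rmorph_sum /=; apply: eq_bigr => i _.
by rewrite mxE DE horner_map.
Qed.

Definition eval_int (t : C) (p : {poly int}) : C := (map_poly (intr : int -> C) p).[t].
HB.instance Definition _ t :=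
  GRing.RMorphism.copy (eval_int t) (horner_eval t \o map_poly (intr : int -> C)).

Lemma normC_real (x : R) : `|rc x| = rc `|x|.
Proof. by rewrite normc_def /= expr0n addr0 sqrtr_sqr. Qed.

Lemma ln_prod (I : Type) (s : seq I) (P : pred I) (F : I -> R) :
  (forall i, P i -> 0 < F i) -> ln (\prod_(i <- s | P i) F i) = \sum_(i <- s | P i) ln (F i).
Proof.
move=> F0; elim: s => [|i s IH]; first by rewrite !big_nil ln1.
rewrite !big_cons; case: ifP => // Pi; rewrite lnM ?IH // posrE ?F0 //.
exact: prodr_gt0.
Qed.

(** The coefficient of the characteristic polynomial of [B] whose index is the
multiplicity of the eigenvalue [0] takes at [theta] the value of the product of
the nonzero eigenvalues, up to sign.  Its norm is at least [1], and its values at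
the other conjugates are at most [(1 + k)^n.+1].  The convention [ln 0 = 0]
discards the eigenvalue [0] from the sum. *)
Lemma sum_ln_eigenvalues n (B : 'M[{poly int}]_n.+1) (theta : C) (s : seq C)
    (k : R) (t : 'I_n.+1 -> R) :
  (forall c : {poly int}, eval_int theta c != 0 ->
     1 <= \prod_(z <- theta :: s) `|eval_int z c|) ->
  0 <= k ->
  {in s, forall z i, \sum_j `|eval_int z (B i j)| <= rc k} ->
  char_poly (map_mx (eval_int theta) B) = \prod_i ('X - (rc (t i))%:P) ->
  - (n.+1 * size s)%:R * ln (1 + k) <= \sum_i ln `|t i|.
Proof.
move=> nrm k0 Bk chE; pose Z := [pred i | t i == 0].
pose c := (char_poly B)`_#|Z|.
have cE z : eval_int z c = (char_poly (map_mx (eval_int z) B))`_#|Z|.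
  by rewrite -map_char_poly coef_map.
pose p := \prod_(i | t i != 0) `|t i|.
have p_gt0 : 0 < p by apply: prodr_gt0 => i ti; rewrite normr_gt0.
have cth : `|eval_int theta c| = rc p.
  rewrite cE chE (bigID Z) /= (eq_bigr (fun=> 'X)); last first.
    by move=> i /eqP ->; rewrite rmorph0 subr0.
  rewrite prodr_const coefXnM ltnn subnn -horner_coef0 horner_prod normr_prod.
  rewrite rmorph_prod; apply: eq_bigr => i _.
  by rewrite hornerXsubC sub0r normrN normC_real.
have lnp : ln p = \sum_i ln `|t i|.
  rewrite ln_prod; last by move=> i ti; rewrite normr_gt0.
  rewrite [RHS](bigID Z) /= [X in X + _]big1 ?add0r // => i /eqP ->.
  by rewrite normr0 ln0.
have c0 : eval_int theta c != 0.
  by rewrite -normr_eq0 cth fmorph_eq0 gt_eqF.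
have := nrm c c0; rewrite big_cons cth.
have le_s : \prod_(z <- s) `|eval_int z c| <= rc ((1 + k) ^+ (n.+1 * size s)).
  elim: (s) Bk => [_|z s' IH Bk]; first by rewrite big_nil muln0 rmorph1.
  rewrite big_cons mulnS exprD rmorphM; apply: ler_pM => //.
  - exact: prodr_ge0.
  - rewrite cE rmorphXn rmorphD rmorph1; apply: coef_char_poly_bound.
      by rewrite ler0c.
    move=> i; under eq_bigr do rewrite mxE.
    by apply: Bk; apply: mem_head.
  - by apply: IH => w ws; apply: Bk; rewrite inE ws orbT.
move=> h; have {h le_s} : 1 <= p * (1 + k) ^+ (n.+1 * size s).
  have : 1 <= rc p * rc ((1 + k) ^+ (n.+1 * size s)).
    by apply: le_trans h _; apply: ler_wpM2l => //; rewrite ler0c ltW.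
  by rewrite -rmorphM -(rmorph1 rc) lecR.
have k1 : 0 < 1 + k by rewrite ltr_pwDl.
rewrite -ler_ln ?posrE ?mulr_gt0 ?exprn_gt0 // ln1 lnM ?posrE ?exprn_gt0 // lnXn //.
rewrite -lnp -mulr_natl; lra.
Qed.
End Hermitian.

(** * Polynomials of Hermitian matrices *)

(** Powers of [1 - ((t - mu) / 2k)^2] work.  The points that are at least as far
from [mu] as [0] is, where the polynomial has to be small, are [0] itself and
those where the bound [ln |t| <= ln (2 |mu|)] may fail. *)
Lemma peak_poly (R : realType) (k mu a : R) :
  0 < `|mu| <= k -> 0 < a ->
  exists sg : {poly R}, sg.[mu] = 1 /\
    forall t, `|t| <= k ->
      0 <= sg.[t] <= 1 /\ (`|mu| <= `|t - mu| -> a * sg.[t] <= 1).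
Proof.
move=> /andP[mu0 muk] a0; have k0 : 0 < k by apply: lt_le_trans muk.
pose w t := ((t - mu) / (2 * k)) ^+ 2.
pose u0 := (`|mu| / (2 * k)) ^+ 2.
have k2 : 0 < 2 * k by lra.
have u01 : 0 < u0 <= 1.
  rewrite exprn_gt0 ?divr_gt0 //=.
  have z0 : 0 < `|mu| / (2 * k) by apply: divr_gt0.
  have z1 : `|mu| / (2 * k) <= 1 by rewrite ler_pdivrMr // mul1r; lra.
  by rewrite exprn_ile1 // ltW.
have [m hm] : exists m : nat, (1 - u0) ^+ m <= a^-1.
  have /cvgrPdist_le /(_ a^-1) : ((1 - u0) ^+ n @[n --> \oo] --> (0 : R))%classic.
    by apply: cvg_expr; rewrite ger0_norm; lra.
  rewrite invr_gt0 => /(_ a0) [m _ /(_ m (leqnn m))] /= h; exists m.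
  by apply: le_trans h; rewrite sub0r normrN ler_norm.
pose sg : {poly R} := (1 - ((2 * k)^-1 *: ('X - mu%:P)) ^+ 2) ^+ m.
have sgE t : sg.[t] = (1 - w t) ^+ m.
  by rewrite /sg horner_exp hornerD hornerN horner_exp hornerZ !hornerE /w [_ / _]mulrC.
exists sg; split; first by rewrite sgE /w subrr mul0r expr0n /= subr0 expr1n.
move=> t tk; have w01 : 0 <= w t <= 1.
  have z1 : `|(t - mu) / (2 * k)| <= 1.
    rewrite normf_div (gtr0_norm k2) ler_pdivrMr // mul1r.
    by have := ler_normB t mu; lra.
  by rewrite /w -real_normK ?num_real // sqr_ge0 exprn_ile1.
rewrite sgE; split; first by rewrite exprn_ge0 ?exprn_ile1 //=; lra.
move=> far; have w_ge : u0 <= w t.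
  rewrite /w -real_normK ?num_real // normf_div (gtr0_norm k2) /u0.
  by rewrite lerXn2r ?nnegrE ?divr_ge0 ?(ltW k2) // ler_pM2r ?invr_gt0.
rewrite -ler_pdivlMl // mulr1; apply: le_trans hm.
by rewrite lerXn2r ?nnegrE //; lra.
Qed.

Section LocalEigenvector.
Variable R : realType.
Notation C := (complex R).
Notation rc := (real_complex R).

Lemma horner_mx_hermitian n (A : 'M[C]_n.+1) (r : {poly R}) :
  (forall i j, A i j = (A j i)^*) ->
  forall i j, horner_mx A (map_poly rc r) i j = (horner_mx A (map_poly rc r) j i)^*.
Proof.
move=> Ah.
have AE : A = map_mx Num.conj A^T by apply/matrixP => i j; rewrite !mxE.
suff ME : horner_mx A (map_poly rc r) = map_mx Num.conj (horner_mx A (map_poly rc r))^T.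
  by move=> i j; rewrite {1}ME !mxE.
elim/poly_ind: r => [|r c IH]; first by rewrite !rmorph0 trmx0 map_mx0.
rewrite rmorphD rmorphM /= map_polyX map_polyC rmorphD rmorphM /= horner_mx_X horner_mx_C.
rewrite linearD /= map_mxD; congr (_ + _); last first.
  by rewrite tr_scalar_mx map_scalar_mx; congr (_%:M); exact/esym/conjc_real.
rewrite -[_ * A]/(_ *m A) trmx_mul map_mxM /= -AE -IH.
exact: (comm_horner_mx (A := A) (B := A)).
Qed.

Lemma trace_sqr_hermitian n (M : 'M[C]_n) :
  (forall i j, M i j = (M j i)^*) -> \tr (M *m M) = \sum_i \sum_j `|M i j| ^+ 2.
Proof.
move=> Mh; apply: eq_bigr => i _; rewrite mxE; apply: eq_bigr => j _.
by rewrite [M j i]Mh normCK.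
Qed.

(** Computing [r(A) y] at [p] only involves the entries of [y] at distance at most
the degree of [r] from [p] in the graph of [A].  The set [W k] is meant as the
set of indices around which [y] is an eigenvector up to distance [k]. *)
Lemma horner_mx_local_eigenvector n (A : 'M[C]_n.+1) (y : 'cV[C]_n.+1) (mu : C)
    (W : nat -> 'I_n.+1 -> Prop) (r : {poly C}) p :
  (forall k q, W k.+1 q -> W k q) ->
  (forall k q q', W k.+1 q -> A q q' != 0 -> W k q') ->
  (forall q, W 1%N q -> (A *m y) q 0 = mu * y q 0) ->
  W (size r) p -> (horner_mx A r *m y) p 0 = r.[mu] * y p 0.
Proof.
move=> Wle WA Wy.
have Wle' k m q : (k <= m)%N -> W m q -> W k q.
  by move=> /subnK <-; elim: (m - k)%N => // j IH /Wle.
have pow k q : W k q -> (A ^+ k *m y) q 0 = mu ^+ k * y q 0.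
  elim: k q => [|k IH] q Wq; first by rewrite expr0 mul1mx expr0 mul1r.
  rewrite exprS -[A * _]/(A *m _) -mulmxA mxE.
  rewrite (eq_bigr (fun q' => mu ^+ k * (A q q' * y q' 0))).
    rewrite -mulr_sumr; have := Wy q (Wle' 1%N k.+1 q isT Wq); rewrite mxE => ->.
    by rewrite exprSr mulrA.
  move=> q' _; have [->|Aq] := eqVneq (A q q') 0; first by rewrite !mul0r mulr0.
  by rewrite (IH _ (WA _ _ _ Wq Aq)) mulrCA.
move=> Wp; rewrite -[r in horner_mx A r]coefK poly_def rmorph_sum /=.
rewrite mulmx_suml summxE horner_coef mulr_suml; apply: eq_bigr => i _.
rewrite linearZ /= rmorphXn /= horner_mx_X -scalemxAl mxE -mulrA pow //.
by apply: Wle' Wp; apply: ltnW.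
Qed.

Lemma cauchy_schwarz n (u v : 'I_n -> C) :
  `|\sum_i u i * v i| ^+ 2 <= (\sum_i `|u i| ^+ 2) * (\sum_i `|v i| ^+ 2).
Proof.
pose U : 'rV[C]_n := \row_i u i; pose V : 'rV[C]_n := \row_i (v i)^*.
have dE (w z : 'rV[C]_n) : dotmx w z = \sum_i w 0 i * (z 0 i)^*.
  transitivity ((w *m map_mx Num.conj z^T) 0 0); first exact: dotmxE.
  by rewrite mxE; apply: eq_bigr => i _; rewrite !mxE.
have [h _] := CauchySchwarz (@dotmx C n) U V.
have {h} : `|dotmx U V| ^+ 2 <= dotmx U U * dotmx V V := h; rewrite !dE.
congr (`|_| ^+ 2 <= _ * _); apply: eq_bigr => i _; rewrite !mxE ?conjCK //.
  by rewrite normCK.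
by rewrite normCK mulrC.
Qed.
End LocalEigenvector.

(** * From a group to its finite models *)

Fixpoint ball (G : groupType) (F : seq G) (k : nat) : seq G :=
  if k is k'.+1 then ball F k' ++ [seq (h * g)%g | h <- F, g <- ball F k'] else [:: 1%g].

Lemma ball_one (G : groupType) (F : seq G) k : 1%g \in ball F k.
Proof. by elim: k => [|k IH]; rewrite ?mem_head //= mem_cat IH. Qed.

Lemma ball_le (G : groupType) (F : seq G) k m :
  (k <= m)%N -> {subset ball F k <= ball F m}.
Proof.
by move=> /subnK <- g; elim: (m - k)%N => // j IH /IH; rewrite addSn /= mem_cat => ->.
Qed.

Section Model.
Variables (R : realType) (G : groupType) (d : nat) (F : seq G)
  (f : 'I_d -> 'I_d -> G -> {poly int}) (T : finType) (act : G -> T -> option T).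
Notation C := (complex R).
Notation rc := (real_complex R).
Hypothesis actV : forall g u v, act g u = Some v -> act g^-1%g v = Some u.
Hypotheses (Funiq : uniq F) (FV : forall h, h \in F -> h^-1%g \in F).

Variables (n : nat) (e : 'I_n.+1 -> 'I_d * T).
Hypothesis ebij : bijective e.

(** The matrix of the group ring element with coefficients [f i j h], [h] in [F],
where the partial action of [h] on [T] replaces left translation. *)
Definition model : 'M[{poly int}]_n.+1 :=
  \matrix_(a, b) \sum_(h <- F | act h (e b).2 == Some (e a).2) f (e a).1 (e b).1 h.

Lemma act_inv_eq h u v : (act h u == Some v) = (act h^-1%g v == Some u).
Proof.
apply/eqP/eqP; first exact: actV.
by move/actV; rewrite invgK.
Qed.

Lemma sum_pairs (V : nmodType) (Phi : 'I_d * T -> V) :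
  \sum_b Phi (e b) = \sum_j \sum_w Phi (j, w).
Proof.
rewrite pair_big /= (reindex e) /=; last by apply: onW_bij.
by apply: eq_bigr => b _; rewrite -surjective_pairing.
Qed.

(** At most one point is sent to [v] by [h], namely the image of [v] under
[h^-1]. *)
Lemma big_act (V : nmodType) h v (X : T -> V) :
  \sum_(w | act h w == Some v) X w = oapp X 0 (act h^-1%g v).
Proof.
under eq_bigl => w do rewrite act_inv_eq.
by case: (act _ v) => [w0|] /=; [rewrite (big_pred1 w0) // => w; rewrite (inj_eq Some_inj) eq_sym | rewrite big_pred0].
Qed.

Lemma model_row_bound (z : C) (k : C) :
  (forall i, \sum_j \sum_(h <- F) `|eval_int z (f i j h)| <= k) ->
  forall a, \sum_b `|eval_int z (model a b)| <= k.
Proof.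
move=> fk a; apply: le_trans (fk (e a).1).
pose Phi (p : 'I_d * T) := `|\sum_(h <- F | act h p.2 == Some (e a).2)
  eval_int z (f (e a).1 p.1 h)|.
rewrite (eq_bigr (fun b => Phi (e b))); last by move=> b _; rewrite mxE rmorph_sum.
rewrite (sum_pairs Phi) /Phi; apply: ler_sum => j _ /=.
apply: (@le_trans _ _ (\sum_w \sum_(h <- F | act h w == Some (e a).2) `|eval_int z (f (e a).1 j h)|)).
  by apply: ler_sum => w _; apply: ler_norm_sum.
rewrite (exchange_big_dep xpredT) //=; apply: ler_sum => h _.
by rewrite (big_act h (e a).2 (fun=> _)); case: (act _ _) => //=.
Qed.

Lemma model_hermitian (theta : C) :
  (forall i j h, h \in F -> eval_int theta (f i j h) = (eval_int theta (f j i h^-1%g))^*) ->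
  forall a b, map_mx (eval_int theta) model a b = (map_mx (eval_int theta) model b a)^*.
Proof.
move=> fh a b; rewrite !mxE !rmorph_sum /=.
have permF : perm_eq F [seq h^-1%g | h <- F].
  apply: uniq_perm => //; first by rewrite map_inj_uniq //; apply: invg_inj.
  move=> h; apply/idP/mapP => [hF|[g gF ->]]; last exact: FV.
  by exists h^-1%g; rewrite ?invgK ?FV.
rewrite [RHS](perm_big _ permF) big_map /= big_seq_cond [RHS]big_seq_cond.
apply: eq_big => [h|h /andP[hF _]]; first by rewrite -act_inv_eq.
exact: fh.
Qed.

Section Chart.
Variables (theta : C) (mu : R) (x : 'I_d -> G -> C) (E : seq G) (beta : G -> T).
Hypothesis binj : {in E &, injective beta}.
Hypothesis bact : forall g y, g \in E -> y \in E -> (g * y)%g \in E ->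
          act g (beta y) = Some (beta (g * y)%g).
Hypothesis FE : {subset F <= E}.
Hypothesis xeig : forall i g,
  \sum_j \sum_(h <- F) eval_int theta (f i j h) * x j (h^-1 * g)%g = rc mu * x i g.
Variables (X2 : R).
Hypothesis xl2 : forall E : seq G, uniq E -> \sum_j \sum_(g <- E) `|x j g| ^+ 2 <= rc X2.

(** The vector [x], transported by the chart [beta] and extended by [0]. *)
Definition transplant (p : 'I_d * T) : C :=
  oapp (x p.1) 0 (ohead [seq g <- E | beta g == p.2]).

Lemma transplantE j g : g \in E -> transplant (j, beta g) = x j g.
Proof.
move=> gE; rewrite /transplant /=.
have : g \in [seq h <- E | beta h == beta g] by rewrite mem_filter eqxx.
have : all (fun h => h == g) [seq h <- E | beta h == beta g].
  by apply/allP => h; rewrite mem_filter => /andP[/eqP e1 hE]; apply/eqP/binj.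
by case: [seq _ <- _ | _] => //= h s /andP[/eqP ->].
Qed.

Lemma transplant_norm : \sum_b `|transplant (e b)| ^+ 2 <= rc X2.
Proof.
rewrite (sum_pairs (fun p => `|transplant p| ^+ 2)).
apply: le_trans (xl2 (undup_uniq E)); apply: ler_sum => j _.
apply: (@le_trans _ _ (\sum_w \sum_(g <- undup E | beta g == w) `|x j g| ^+ 2)); last first.
  rewrite (exchange_big_dep xpredT) //=; apply: ler_sum => g _.
  by rewrite (big_pred1 (beta g)) // => w; rewrite eq_sym.
apply: ler_sum => w _; rewrite /transplant /=.
case s_eq : [seq g <- E | beta g == w] => [|g s] /=.
  by rewrite normr0 expr0n sumr_ge0.
have : g \in [seq g <- E | beta g == w] by rewrite s_eq mem_head.
rewrite mem_filter => /andP[gw gE].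
rewrite (big_rem g) ?mem_undup //= gw lerDl sumr_ge0 // => h _.
Qed.

(** Inside the chart, the model is left convolution, of which [x] is an
eigenvector; the second part says that the entries of row [q] sit inside the
chart as well. *)
Lemma model_local q i g :
  e q = (i, beta g) -> g \in E -> {in F, forall h, (h^-1 * g)%g \in E} ->
  (map_mx (eval_int theta) model *m \col_b transplant (e b)) q 0 =
    rc mu * transplant (e q) /\
  forall q', map_mx (eval_int theta) model q q' != 0 ->
    exists j h, h \in F /\ e q' = (j, beta (h^-1 * g)%g).
Proof.
move=> eq gE hgE.
have act_hg h : h \in F -> act h^-1%g (beta g) = Some (beta (h^-1 * g)%g).
  by move=> hF; apply: bact; rewrite ?hgE // FE // FV.
split.
  pose Phi (p : 'I_d * T) := (\sum_(h <- F | act h p.2 == Some (beta g))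
    eval_int theta (f i p.1 h)) * transplant p.
  rewrite mxE (eq_bigr (fun b => Phi (e b))); last first.
    by move=> b _; rewrite !mxE rmorph_sum eq.
  rewrite (sum_pairs Phi) /Phi eq transplantE // -xeig; apply: eq_bigr => j _ /=.
  under eq_bigr do rewrite mulr_suml.
  rewrite (exchange_big_dep xpredT) //= big_seq [RHS]big_seq; apply: eq_bigr => h hF.
  by rewrite -mulr_sumr big_act act_hg //= transplantE // hgE.
move=> q'; rewrite !mxE eq /= => nz.
have [h hF hq] : exists2 h, h \in F & act h (e q').2 == Some (beta g).
  apply: contrapT => no; move/eqP: nz; apply.
  rewrite big_seq_cond big_pred0 ?rmorph0 // => h; apply/negbTE/negP => /andP[hF hh].
  by apply: no; exists h.
exists (e q').1, h; split=> //; rewrite [LHS]surjective_pairing; congr pair.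
by move: hq; rewrite act_inv_eq act_hg // => /eqP [].
Qed.
End Chart.

(** The transplanted vector [y] satisfies [sg(B) y = sg(mu) y] at the centre [p] of
the chart; apply Cauchy-Schwarz to row [p]. *)
Lemma row_mass_lower_bound (theta : C) (mu : R) (x : 'I_d -> G -> C) (X2 : R)
    (sg : {poly R}) (v : T) (i0 : 'I_d) (p : 'I_n.+1)
    (A := map_mx (eval_int theta) model) :
  (forall i g, \sum_j \sum_(h <- F) eval_int theta (f i j h) * x j (h^-1 * g)%g = rc mu * x i g) ->
  (forall E : seq G, uniq E -> \sum_j \sum_(g <- E) `|x j g| ^+ 2 <= rc X2) ->
  good_point (F ++ ball F (size sg)) act v -> sg.[mu] = 1 -> e p = (i0, v) ->
  `|x i0 1%g| ^+ 2 <= rc X2 * \sum_c `|horner_mx A (map_poly rc sg) p c| ^+ 2.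
Proof.
move=> xeig xl2 [beta [b1 binj bact]] sg1 ep.
pose M := horner_mx A (map_poly rc sg); pose E := F ++ ball F (size sg).
pose y : 'cV[C]_n.+1 := \col_b transplant x E beta (e b).
(* The index [q] is in the chart, together with the ball of radius [j] around
   it. *)
pose W j q := exists i g, [/\ (j <= size sg)%N, g \in ball F (size sg - j) & e q = (i, beta g)].
have BE : {subset ball F (size sg) <= E} by move=> g gB; rewrite mem_cat gB orbT.
have FE : {subset F <= E} by move=> g gF; rewrite mem_cat gF.
have Wball j g h : (j < size sg)%N -> g \in ball F (size sg - j.+1) -> h \in F ->
    (h^-1 * g)%g \in ball F (size sg - j).
  move=> js gB hF; rewrite -(subnSK js) /= mem_cat; apply/orP; right.
  by apply/allpairsP; exists (h^-1%g, g); split=> //; apply: FV.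
have loc j q i g : (j < size sg)%N -> g \in ball F (size sg - j.+1) -> e q = (i, beta g) ->
    (A *m y) q 0 = rc mu * transplant x E beta (e q) /\
    forall q', A q q' != 0 -> exists j h, h \in F /\ e q' = (j, beta (h^-1 * g)%g).
  move=> js gB eq; apply: (model_local binj bact FE xeig) eq _ _.
    by apply: BE; apply: ball_le gB; apply: leq_subr.
  by move=> h hF; apply: BE; apply: ball_le (Wball _ _ _ js gB hF); apply: leq_subr.
have key : (M *m y) p 0 = (map_poly rc sg).[rc mu] * y p 0.
  apply: (@horner_mx_local_eigenvector _ _ _ _ _ W).
  - move=> j q [i [g [js gB eq]]]; exists i, g; split=> //; first exact: ltnW.
    by apply: ball_le gB; rewrite leq_sub2l.
  - move=> j q q' [i [g [js gB eq]]] Aq.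
    have [_ /(_ q' Aq) [i' [h [hF eq']]]] := loc _ _ _ _ js gB eq.
    by exists i', (h^-1 * g)%g; split=> //; [exact: ltnW | exact: Wball].
  - by move=> q [i [g [js gB eq]]]; have [-> _] := loc _ _ _ _ js gB eq; rewrite mxE.
  - rewrite size_map_poly; exists i0, 1%g; split=> //; first by rewrite subnn mem_head.
    by rewrite ep b1.
move: key; rewrite horner_map sg1 rmorph1 mul1r mxE [RHS]mxE ep -b1.
rewrite transplantE //; last by apply: BE; apply: ball_one.
move=> <-; apply: le_trans (cauchy_schwarz _ _) _; rewrite mulrC.
apply: ler_wpM2r; first by apply: sumr_ge0 => c _; apply: exprn_ge0.
under eq_bigr do rewrite mxE.
exact: transplant_norm.
Qed.
End Model.

Section SoficBound.
Variable R : realType.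
Notation C := (complex R).
Notation rc := (real_complex R).

(** The function [ln k + 1 - a sg^2] dominates [ln |t|] on [[- k, k]], so that its
sum over the eigenvalues is bounded below by [sum_ln_eigenvalues]. *)
Lemma small_eigenvalue_mass n (B : 'M[{poly int}]_n.+1) (theta : C) (s : seq C)
    (k mu : R) (sg : {poly R}) (a := - ln (2 * `|mu|))
    (A := map_mx (eval_int theta) B) :
  (forall c : {poly int}, eval_int theta c != 0 ->
     1 <= \prod_(z <- theta :: s) `|eval_int z c|) ->
  1 <= k ->
  (forall z, z \in theta :: s -> forall i, \sum_j `|eval_int z (B i j)| <= rc k) ->
  (forall i j, A i j = (A j i)^*) ->
  0 < `|mu| < 2^-1 ->
  (forall t, `|t| <= k ->
     0 <= sg.[t] <= 1 /\ (`|mu| <= `|t - mu| -> a * sg.[t] <= 1)) ->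
  exists2 S : R,
    \sum_b \sum_c `|horner_mx A (map_poly rc sg) b c| ^+ 2 = rc S
    & a * S <= n.+1%:R * (ln k + 1 + (size s)%:R * ln (1 + k)).
Proof.
move=> nrm k1 Bk Ah /andP[mu0 mu2] sgP; have k0 : 0 <= k by lra.
have a0 : 0 < a by rewrite oppr_gt0 ln_lt0 //; lra.
have lnk : 0 <= ln k by apply: ln_ge0.
have [t [chA trA]] := hermitian_eigenvalues Ah.
have tk b : `|t b| <= k.
  rewrite -lecR -normC_real; apply: (@eigenvalue_bound _ _ A) => [c|].
    by under eq_bigr do rewrite mxE; apply: Bk; apply: mem_head.
  rewrite eigenvalue_root_char chA /root horner_prod; apply/prodf_eq0.
  by exists b; rewrite // hornerXsubC subrr.
have lnsum : - (n.+1 * size s)%:R * ln (1 + k) <= \sum_b ln `|t b|.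
  apply: (sum_ln_eigenvalues nrm k0 _ chA) => z zs; apply: Bk.
  by rewrite inE zs orbT.
(* Far from [mu], the peak costs at most [1].  A point that is strictly closer to
   [mu] than [0] is nonzero and has absolute value at most [2 |mu|], hence the
   logarithm of this value is at most [- a]. *)
have up b : ln `|t b| <= ln k + 1 - a * sg.[t b] ^+ 2.
  have [/andP[s0 s1] far] := sgP _ (tk b).
  have s2 : sg.[t b] ^+ 2 <= sg.[t b] by rewrite expr2 ler_piMl.
  have [close|/far fs] := ltP `|t b - mu| `|mu|; last first.
    have : a * sg.[t b] ^+ 2 <= a * sg.[t b] by rewrite ler_pM2l.
    suff : ln `|t b| <= ln k by lra.
    have [->|t0] := eqVneq (t b) 0; first by rewrite normr0 ln0.
    by rewrite ler_ln ?posrE ?normr_gt0 //; lra.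
  have t0 : t b != 0 by apply: contraTneq close => ->; rewrite sub0r normrN ltxx.
  have : ln `|t b| <= ln (2 * `|mu|).
    rewrite ler_ln ?posrE ?normr_gt0 ?mulr_gt0 //.
    by have := ler_normD (t b - mu) mu; rewrite subrK; lra.
  have : a * sg.[t b] ^+ 2 <= a by rewrite ger_pMr //; lra.
  by rewrite /a; lra.
have mass : a * \sum_b sg.[t b] ^+ 2 <= n.+1%:R * (ln k + 1 + (size s)%:R * ln (1 + k)).
  have := ler_sum (index_enum _) (fun b (_ : true) => up b).
  rewrite big_split /= sumr_const card_ord sumrN -mulr_sumr -[X in X - _]mulr_natl.
  by rewrite natrM in lnsum; lra.
exists (\sum_b sg.[t b] ^+ 2) => //.
rewrite -trace_sqr_hermitian; last exact: horner_mx_hermitian.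
rewrite -[_ *m _]/(_ * _) -expr2 -!rmorphXn trA.
by congr rc; apply: eq_bigr => b _; rewrite horner_exp.
Qed.

(** On a model at least half of whose points are good, bound the trace of
[sg(B)^2] from below by the rows at the good points, and from above by
[small_eigenvalue_mass].  The number of points of the model cancels. *)
Lemma sofic_eigenvector_bound (G : groupType) (d : nat) (F : seq G)
    (f : 'I_d -> 'I_d -> G -> {poly int}) (theta : C) (s : seq C) (k mu X2 : R)
    (x : 'I_d -> G -> C) (i0 : 'I_d) :
  sofic G -> uniq F -> (forall h, h \in F -> h^-1%g \in F) ->
  (forall c : {poly int}, eval_int theta c != 0 ->
     1 <= \prod_(z <- theta :: s) `|eval_int z c|) ->
  1 <= k ->
  {in theta :: s, forall z i, \sum_j \sum_(h <- F) `|eval_int z (f i j h)| <= rc k} ->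
  (forall i j h, h \in F -> eval_int theta (f i j h) = (eval_int theta (f j i h^-1%g))^*) ->
  (forall i g, \sum_j \sum_(h <- F) eval_int theta (f i j h) * x j (h^-1 * g)%g = rc mu * x i g) ->
  (forall E : seq G, uniq E -> \sum_j \sum_(g <- E) `|x j g| ^+ 2 <= rc X2) ->
  0 < `|mu| < 2^-1 ->
  complex.Re (`|x i0 1%g| ^+ 2) * - ln (2 * `|mu|) <=
    X2 * (2 * d%:R * (ln k + 1 + (size s)%:R * ln (1 + k))).
Proof.
move=> sofG Funiq FV nrm k1 frow fherm xeig xl2 muP; have /andP[mu0 mu2] := muP.
set a := - ln (2 * `|mu|); have a0 : 0 < a by rewrite oppr_gt0 ln_lt0 //; lra.
have X20 : 0 <= X2 by have := xl2 [::] isT; rewrite big1 ?ler0c // => j _; rewrite big_nil.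
have [|sg [sg1 sgP]] := @peak_poly R k mu a _ a0; first by rewrite mu0 /=; lra.
pose E := F ++ ball F (size sg).
have [T [act [T_gt0 actV bad]]] := sofG E 2%N.
have [n nE] : exists n, #|{: 'I_d * T}| = n.+1.
  exists #|{: 'I_d * T}|.-1; rewrite prednK // card_prod card_ord muln_gt0 T_gt0 andbT.
  exact: leq_trans (ltn_ord i0).
pose e (b : 'I_n.+1) : 'I_d * T := enum_val (cast_ord (esym nE) b).
pose e' (p : 'I_d * T) : 'I_n.+1 := cast_ord nE (enum_rank p).
have e'K : cancel e' e by move=> p; rewrite /e /e' cast_ordK enum_rankK.
have eK : cancel e e' by move=> b; rewrite /e /e' enum_valK cast_ordKV.
have ebij : bijective e by exists e'.
pose B := model F f act e; pose A := map_mx (eval_int theta) B.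
have Bk z : z \in theta :: s -> forall b, \sum_j `|eval_int z (B b j)| <= rc k.
  by move=> zs b; apply: model_row_bound => //; exact: frow.
have Ah : forall b c, A b c = (A c b)^* by apply: model_hermitian.
have [S massM mass] := small_eigenvalue_mass nrm k1 Bk Ah muP sgP.
have good v : good_point E act v ->
    `|x i0 1%g| ^+ 2 <= rc X2 * \sum_c `|horner_mx A (map_poly rc sg) (e' (i0, v)) c| ^+ 2.
  by move=> gv; apply: (row_mass_lower_bound actV FV ebij xeig xl2 gv); rewrite ?e'K.
pose c0 := complex.Re (`|x i0 1%g| ^+ 2).
have c0E : `|x i0 1%g| ^+ 2 = rc c0 by rewrite RRe_real // realX // normr_real.
pose gd := [set v | `[< good_point E act v >]].
have total : rc (#|gd|%:R * c0) <= rc (X2 * S).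
  rewrite rmorphM [X in _ <= X]rmorphM /= -massM rmorph_nat -c0E mulr_natl -sumr_const.
  rewrite mulr_sumr; apply: (@le_trans _ _ (\sum_(v in gd) rc X2 * \sum_c `|horner_mx A (map_poly rc sg) (e' (i0, v)) c| ^+ 2)).
    by apply: ler_sum => v; rewrite finset.in_set => /asboolP; apply: good.
  rewrite [X in _ <= X](reindex e') /=; last by apply: onW_bij; exists e.
  pose Psi j v := rc X2 * \sum_c `|horner_mx A (map_poly rc sg) (e' (j, v)) c| ^+ 2.
  rewrite [X in _ <= X](eq_bigr (fun p => Psi p.1 p.2)); last by case.
  rewrite -(pair_bigA _ Psi) /Psi /=.
  have nn j v : 0 <= rc X2 * \sum_c `|horner_mx A (map_poly rc sg) (e' (j, v)) c| ^+ 2.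
    by rewrite mulr_ge0 ?ler0c // sumr_ge0 // => c _; apply: exprn_ge0.
  rewrite (bigD1 i0) //= -[X in X <= _]addr0; apply: lerD; last first.
    by apply: sumr_ge0 => j _; apply: sumr_ge0 => v _; apply: nn.
  rewrite [X in _ <= X](bigID (mem gd)) /= lerDl.
  by apply: sumr_ge0 => v _; apply: nn.
rewrite lecR in total.
have gdT : (#|T| <= #|gd| * 2)%N.
  have badE : ~: gd = [set v | ~~ `[< good_point E act v >]].
    by apply/finset.setP => v; rewrite !inE.
  have cardT := cardsC gd; rewrite badE in cardT.
  move: bad; rewrite -cardT !muln2 -!addnn leq_add2r.
  by rewrite leq_add2l.
have c00 : 0 <= c0 by rewrite -ler0c -c0E exprn_ge0.
have TR : (0 : R) < #|T|%:R by rewrite ltr0n.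
have nT : n.+1%:R = d%:R * #|T|%:R :> R by rewrite -natrM -nE card_prod card_ord.
have gdT' : #|T|%:R <= #|gd|%:R * 2 :> R by rewrite -natrM ler_nat.
rewrite -(ler_pM2l TR).
set K := ln k + 1 + _ in mass *.
have h1 : #|T|%:R * (c0 * a) <= 2 * (a * (#|gd|%:R * c0)).
  have : #|T|%:R * (c0 * a) <= #|gd|%:R * 2 * (c0 * a).
    by rewrite ler_wpM2r // mulr_ge0 // ltW.
  by lra.
have h2 : a * (#|gd|%:R * c0) <= X2 * (a * S).
  by rewrite [X in _ <= X]mulrCA ler_pM2l.
have h3 : X2 * (a * S) <= X2 * (n.+1%:R * K) by rewrite ler_wpM2l.
rewrite nT in h3; rewrite -/c0; nra.
Qed.
End SoficBound.

(** * Eigenvalues close to rational numbers *)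

Section Final.
Variable R : realType.
Notation C := (complex R).
Notation rc := (real_complex R).

(** As [n] grows, [c0 n l] beats [X K1 l]; the constants [X K2] and [c0 L] are at
most fixed multiples of [l] because [l] is bounded away from [0].  So [n] can be
chosen uniformly in [l]. *)
Lemma growth_gap (c0 X K1 K2 L : R) (m : nat) :
  0 < c0 -> 0 <= X * K2 -> 0 <= L ->
  exists n : nat, (m <= n)%N /\ forall l : R, ln 2 <= l ->
    X * (K1 * l + K2) < c0 * (n%:R * l - L).
Proof.
move=> c00 XK2 L0; have ln2 : 0 < ln (2 : R) by rewrite ln_gt0 // ltr1n.
pose Z := (X * K1 + (X * K2 + c0 * L) / ln 2) / c0.
exists (maxn m (Num.bound `|Z|)); split; first exact: leq_maxl.
move=> l hl; have l0 : 0 < l by lra.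
have Zn : Z < (maxn m (Num.bound `|Z|))%:R.
  apply: (le_lt_trans (ler_norm Z)); apply: lt_le_trans (archi_boundP (normr_ge0 Z)) _.
  by rewrite ler_nat leq_maxr.
set n := _%:R in Zn *.
have h1 : c0 * Z = X * K1 + (X * K2 + c0 * L) / ln 2 by rewrite /Z mulrC divfK ?gt_eqF.
have h2 : X * K2 + c0 * L <= (X * K2 + c0 * L) / ln 2 * l.
  rewrite mulrAC ler_pdivlMr // ler_wpM2l //; nra.
have h3 : c0 * Z * l < c0 * n * l by rewrite ltr_pM2r // ltr_pM2l.
rewrite h1 in h3; nra.
Qed.

Lemma l2_partial_sums (G : groupType) (d : nat) (x : 'I_d -> G -> C) :
  in_l2 x -> exists X2 : R, forall E : seq G, uniq E ->
    \sum_j \sum_(g <- E) `|x j g| ^+ 2 <= rc X2.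
Proof.
move=> x2.
have bnd j : exists X : R, forall E : seq G, uniq E -> \sum_(g <- E) `|x j g| ^+ 2 <= rc X.
  have := x2 j; set S := esum _ _ => Sfin.
  have nn g : (0 <= (ComplexField.Normc.normc (x j g) ^+ 2)%:E :> \bar R)%E.
    by rewrite lee_fin sqr_ge0.
  have Sfn : S \is a fin_num by rewrite ge0_fin_numE // esum_ge0.
  exists (fine S) => E uE.
  have -> : \sum_(g <- E) `|x j g| ^+ 2 =
      rc (\sum_(g <- E) ComplexField.Normc.normc (x j g) ^+ 2).
    by rewrite rmorph_sum; apply: eq_bigr => g _; rewrite rmorphXn.
  rewrite lecR -lee_fin fineK // -sumEFin; apply: esum_ge.
  exists [set` E]%classic; first by split; [exact: finite_seq | exact: subsetT].
  by rewrite -fsbig_seq.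
have /boolp.choice [X XP] := bnd.
exists (\sum_j X j) => E uE; rewrite rmorph_sum; apply: ler_sum => j _; exact: XP.
Qed.

Lemma sum_finsupp (G : groupType) (a : group_ring R G) (F : seq G) (X : G -> C) :
  uniq F -> {subset finsupp a <= F} ->
  \sum_(h <- finsupp a) a h * X h = \sum_(h <- F) a h * X h.
Proof.
move=> uF sF; rewrite [RHS](bigID (mem (finsupp a))) /= [X in _ + X]big1 ?addr0.
  rewrite -[RHS]big_filter; apply: perm_big; apply: uniq_perm.
  - exact: fset_uniq.
  - exact: filter_uniq.
  - by move=> h; rewrite mem_filter; apply/idP/andP => [ha|[]//]; split=> //; apply: sF.
by move=> h; rewrite memNfinsupp => /eqP ->; rewrite mul0r.
Qed.

Lemma gr_adjointE (G : groupType) d (A : 'M[group_ring R G]_d) i j h :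
  gr_adjoint A i j h = (A j i h^-1%g)^*.
Proof.
rewrite mxE /gr_star fsfunE; case: ifP => // /negbT hn.
rewrite (_ : A j i h^-1%g = 0) ?rmorph0 //; apply/eqP; rewrite -memNfinsupp.
apply: contra hn => hs; apply/imfsetP; exists h^-1%g => //=; by rewrite invgK.
Qed.


Lemma group_ring_integral_form (G : groupType) d (A : 'M[group_ring R G]_d) :
  algebraic_coefficients A ->
  exists (F : seq G) (N : nat) (theta : C) (s : seq C)
    (f : 'I_d -> 'I_d -> G -> {poly int}),
    [/\ uniq F, (forall h, h \in F -> h^-1%g \in F), 1%g \in F,
        (forall i j, {subset finsupp (A i j) <= F})
      & [/\ (0 < N)%N, (forall c : {poly int}, eval_int theta c != 0 ->
           1 <= \prod_(z <- theta :: s) `|eval_int z c|)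
      & forall i j h, h \in F -> N%:R * A i j h = eval_int theta (f i j h)]].
Proof.
move=> alg.
pose F0 := flatten [seq enum_fset (finsupp (A p.1 p.2)) | p <- enum {: 'I_d * 'I_d}].
pose F := undup (1 :: F0 ++ [seq h^-1 | h <- F0])%g.
pose cs := [seq A p.1 p.2 h | p <- enum {: 'I_d * 'I_d}, h <- F].
have [|N [theta [s [N0 nrm rep]]]] := @conjugate_system C cs.
  by move=> c /allpairsP [[p h] /= [_ _ ->]]; apply: alg.
have FP h : (h \in F) = [|| h == 1%g, h \in F0 | h^-1%g \in F0].
  rewrite mem_undup inE mem_cat; congr [|| _, _ | _].
  by apply/mapP/idP => [[g gF ->]|hF]; [rewrite invgK|exists h^-1%g; rewrite ?invgK].
have choice_f (p : 'I_d * 'I_d * G) : exists f : {poly int},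
    p.2 \in F -> N%:R * A p.1.1 p.1.2 p.2 = eval_int theta f.
  have [pF|pF] := boolP (p.2 \in F); last by exists 0.
  have [|f fE] := rep (A p.1.1 p.1.2 p.2); last by exists f.
  by apply/allpairsP; exists (p.1, p.2); rewrite mem_enum.
have [f fP] := boolp.choice choice_f.
exists F, N, theta, s, (fun i j h => f (i, j, h)); split.
- exact: undup_uniq.
- by move=> h; rewrite !FP invgK invg_eq1 => /or3P[] ->; rewrite ?orbT.
- by rewrite FP eqxx.
- move=> i j h hA; rewrite FP; apply/orP; right; apply/orP; left.
  by apply/flatten_mapP; exists (i, j); rewrite ?mem_enum.
- by split=> // i j h hF; apply: (fP (i, j, h)).
Qed.


Lemma eval_int_shift (z : C) (q : nat) (g : {poly int}) (c : int) :
  eval_int z (q%:Z *: g - c%:P) = q%:R * eval_int z g - c%:~R.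
Proof. by rewrite rmorphB /= -mul_polyC rmorphM /= /eval_int !map_polyC !hornerC. Qed.

Lemma sum_delta (V : nmodType) (G : groupType) (d : nat) (F : seq G) (i : 'I_d)
    (Phi : 'I_d -> G -> V) :
  uniq F -> 1%g \in F ->
  \sum_j \sum_(h <- F) Phi j h *+ ((i == j) && (h == 1%g)) = Phi i 1%g.
Proof.
move=> uF F1; rewrite (bigD1 i) //= [X in _ + X]big1 ?addr0 => [|j ji]; last first.
  by rewrite big1 // => h _; rewrite eq_sym (negPf ji) mulr0n.
rewrite (bigD1_seq 1%g) //= !eqxx mulr1n big1 ?addr0 // => h h1.
by rewrite (negPf h1) andbF mulr0n.
Qed.

End Final.

Theorem theorem4p15 (R : realType) (G : groupType) (hG : classG R G)
    (d : nat) (A : 'M[group_ring R G]_d)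
    (hAalg : algebraic_coefficients A) (hA : A = gr_adjoint A)
    (lambda : R)
    (htrans : ~ algebraicOver (ratr : rat -> R) lambda)
    (happrox : forall n : nat, exists (p : int) (q : nat),
       (2 <= q)%N /\
       0 < `|lambda - p%:~R / q%:R| <= 1 / q%:R ^+ n) :
  ~ is_eigenvalue A (real_complex R lambda).
Proof.
move=> [x0 [x0_l2 [i0 [g0 xn0]] x0_eig]].
have sofG := classG_sofic hG.
have [F [N [theta [s [f [uF FV F1 AF [N0 nrm fE]]]]]]] := group_ring_integral_form hAalg.
(* Right translation commutes with left convolution and brings a nonzero value of
   the eigenvector to [1]. *)
pose x j g := x0 j (g * g0)%g.
have [X2 X2P] := l2_partial_sums x0_l2.
have xl2 (E : seq G) : uniq E -> \sum_j \sum_(g <- E) `|x j g| ^+ 2 <= real_complex R X2.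
  move=> uE; have uE' : uniq [seq (g * g0)%g | g <- E].
    by rewrite map_inj_uniq //; apply: mulIg.
  apply: le_trans (X2P _ uE'); apply: ler_sum => j _; by rewrite big_map.
have xeig i g : \sum_j \sum_(h <- F) A i j h * x j (h^-1 * g)%g = real_complex R lambda * x i g.
  rewrite /x -x0_eig /gr_act; apply: eq_bigr => j _.
  rewrite (sum_finsupp (fun h => x0 j (h^-1 * (g * g0))%g) uF (AF i j)).
  by apply: eq_bigr => h _; rewrite mulgA.
pose c0 := complex.Re (`|x i0 1%g| ^+ 2).
have c00 : 0 < c0.
  rewrite -ltcR RRe_real ?realX ?normr_real // exprn_gt0 // normr_gt0.
  by rewrite /x mul1g.
(* [q * c1] bounds the row sums of the conjugates of [N (q A - p)], where [|p|] is
   at most [q (|lambda| + 1)]. *)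
pose sumf := \sum_(z <- theta :: s) \sum_i \sum_j \sum_(h <- F)
   ComplexField.Normc.normc (eval_int z (f i j h)).
pose c1 := 1 + N%:R * (`|lambda| + 1) + sumf.
have nn z i j h : 0 <= ComplexField.Normc.normc (eval_int z (f i j h)).
  by rewrite -ler0c; exact: (normr_ge0 (eval_int z (f i j h))).
have sumf0 : 0 <= sumf by do 4![apply: sumr_ge0 => ? _].
have row_f z i : z \in theta :: s ->
    \sum_j \sum_(h <- F) ComplexField.Normc.normc (eval_int z (f i j h)) <= sumf.
  rewrite /sumf; move: (theta :: s) => t zs.
  rewrite (big_rem z) //= [X in _ <= X + _](bigD1 i) //= -addrA lerDl.
  by apply: addr_ge0; do 4?[apply: sumr_ge0 => ? _].
have NR : 1 <= N%:R :> R by rewrite ler1n.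
have Nl : 0 <= N%:R * (`|lambda| + 1) by rewrite mulr_ge0 ?addr_ge0.
have c11 : 1 <= c1 by rewrite /c1 -addrA lerDl addr_ge0.
have X20 : 0 <= X2 by have := xl2 [::] isT; rewrite big1 ?ler0c // => j _; rewrite big_nil.
pose e : R := (size s)%:R.
have e0 : 0 <= e by rewrite ler0n.
(* The bound [2 N < n] makes [|mu|] smaller than [1/2], as [2 N < n < q^n]. *)
have [||n [nN gap]] := @growth_gap R c0 (X2 * (2 * d%:R)) (1 + e)
  (ln c1 + 1 + e * ln (2 * c1)) (ln (2 * N%:R)) (2 * N).+1 c00.
- by rewrite mulr_ge0 ?mulr_ge0 ?ler0n ?addr_ge0 ?mulr_ge0 ?ln_ge0 //; lra.
- by rewrite ln_ge0 //; lra.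
have [p [q [q2 /andP[pq0 pqn]]]] := happrox n.+1.
have q0 : 0 < q%:R :> R by rewrite ltr0n ltnW.
have q1 : 1 <= q%:R :> R by rewrite ler1n ltnW.
have qn0 : 0 < q%:R ^+ n :> R by rewrite exprn_gt0.
pose mu : R := N%:R * (q%:R * lambda - p%:~R).
have muE : `|mu| = N%:R * q%:R * `|lambda - p%:~R / q%:R|.
  rewrite /mu normrM ger0_norm ?ler0n // -mulrA; congr (_ * _).
  by rewrite -[X in X * `|_|]gtr0_norm // -normrM mulrBr mulrCA divff ?gt_eqF // mulr1.
have mu0 : 0 < `|mu| by rewrite muE !mulr_gt0 // ltr0n.
have mun : `|mu| <= N%:R / q%:R ^+ n.
  rewrite muE; apply: le_trans (_ : N%:R * q%:R * (1 / q%:R ^+ n.+1) <= _).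
    by rewrite ler_pM2l // mulr_gt0 // ltr0n.
  by rewrite mul1r exprS invfM mulrA mulfK ?gt_eqF.
have qn_big : 2 * N%:R < q%:R ^+ n :> R.
  rewrite -natrX -natrM ltr_nat; apply: (leq_trans nN).
  exact: ltnW (ltn_expl n q2).
have mu2 : `|mu| < 2^-1.
  by apply: le_lt_trans mun _; rewrite ltr_pdivrMr // ltr_pdivlMl.
have pbound : `|p%:~R : R| <= q%:R * (`|lambda| + 1).
  have h1 : `|lambda - p%:~R / q%:R| <= 1.
    by apply: le_trans pqn _; rewrite ler_pdivrMr ?exprn_gt0 // mul1r exprn_ege1.
  have -> : p%:~R = q%:R * (p%:~R / q%:R) :> R by rewrite mulrC divfK ?gt_eqF.
  rewrite normrM gtr0_norm // ler_pM2l //.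
  by have := ler_normB lambda (lambda - p%:~R / q%:R); rewrite subKr; lra.
pose c (i j : 'I_d) (h : G) : int := (N%:Z * p) *+ ((i == j) && (h == 1%g)).
pose f' (i j : 'I_d) (h : G) : {poly int} := q%:Z *: f i j h - (c i j h)%:P.
have k1 : 1 <= q%:R * c1 by have := ler_pM ler01 ler01 q1 c11; rewrite mulr1.
have AE i j h : A i j h = (A j i h^-1%g)^* by rewrite {1}hA gr_adjointE.
have : c0 * - ln (2 * `|mu|) <=
    X2 * (2 * d%:R * (ln (q%:R * c1) + 1 + e * ln (1 + q%:R * c1))).
  apply: (@sofic_eigenvector_bound R G d F f' theta s _ mu X2 x i0 sofG uF FV nrm k1 _ _ _ xl2).
- move=> z zs i; rewrite /f'.
  apply: (@le_trans _ _ (\sum_j \sum_(h <- F) (real_complex R (q%:R * ComplexField.Normc.normc (eval_int z (f i j h))) +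
     real_complex R (N%:R * `|p%:~R|) *+ ((i == j) && (h == 1%g))))).
    apply: ler_sum => j _; apply: ler_sum => h _; rewrite eval_int_shift.
    apply: le_trans (ler_normB _ _) _; apply: lerD.
      by rewrite normrM rmorphM rmorph_nat normr_nat.
    rewrite /c; case: (_ && _); rewrite ?mulr0n ?normr0 ?mulr1n //.
    by rewrite intrM normrM -pmulrn normr_nat rmorphM /= rmorph_nat -normC_real rmorph_int.
  under eq_bigr do rewrite big_split /=.
  rewrite big_split /= sum_delta //.
  under eq_bigr do rewrite -rmorph_sum -mulr_sumr.
  rewrite -rmorph_sum -mulr_sumr -rmorphD lecR.
  have h1 := row_f z i zs.
  have h2 : N%:R * `|p%:~R| <= N%:R * (q%:R * (`|lambda| + 1)) :> R by rewrite ler_wpM2l ?ler0n.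
  have h3 : q%:R * \sum_j \sum_(h <- F) ComplexField.Normc.normc (eval_int z (f i j h)) <= q%:R * sumf.
    by rewrite ler_wpM2l ?ler0n.
  by rewrite /c1; lra.
- move=> i j h hF; rewrite /f' !eval_int_shift -!fE ?FV // rmorphB /=.
  rewrite (AE i j h) !rmorphM /= !rmorph_nat rmorph_int.
  by rewrite /c eq_sym invg_eq1.
- move=> i g; rewrite /f' /mu.
  under eq_bigr => j _.
    rewrite big_seq; under eq_bigr => h hF.
      rewrite eval_int_shift -fE // mulrBl !mulrA -mulrA.
      over.
    rewrite -big_seq sumrB.
    over.
  rewrite sumrB.
  have -> : \sum_j \sum_(h <- F) q%:R * (N%:R * A i j h) * x j (h^-1 * g)%g =
      q%:R * N%:R * (real_complex R lambda * x i g).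
    rewrite -xeig mulr_sumr; apply: eq_bigr => j _; rewrite mulr_sumr.
    by apply: eq_bigr => h _; rewrite !mulrA.
  have -> : \sum_j \sum_(h <- F) (c i j h)%:~R * x j (h^-1 * g)%g =
      N%:R * p%:~R * x i g.
    transitivity (N%:R * p%:~R * x i (1^-1 * g)%g); last by rewrite invg1 mul1g.
    rewrite -(sum_delta i (fun j h => N%:R * p%:~R * x j (h^-1 * g)%g) uF F1).
    apply: eq_bigr => j _; apply: eq_bigr => h _; rewrite /c.
    by case: (_ && _); rewrite ?mulr0n ?mul0r // !mulr1n intrM -pmulrn.
  rewrite rmorphM rmorphB rmorphM /= !rmorph_nat rmorph_int; ring.
- by rewrite mu0.
pose l : R := ln q%:R.
have ln2l : ln 2 <= l by rewrite ler_ln ?posrE // ler_nat.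
have c10 : 0 < c1 by lra.
have lnq1 : ln (q%:R * c1) = l + ln c1 by rewrite lnM ?posrE.
have lnq2 : ln (1 + q%:R * c1) <= l + ln (2 * c1).
  have c20 : 0 < 2 * c1 by lra.
  have qc0 : 0 < 1 + q%:R * c1 by lra.
  rewrite -lnM ?posrE // ler_ln ?posrE ?mulr_gt0 //.
  by rewrite mulrCA; lra.
have lnmu : ln (2 * `|mu|) <= ln (2 * N%:R) - n%:R * l.
  have -> : n%:R * l = ln (q%:R ^+ n) by rewrite lnXn // mulr_natl.
  rewrite -ln_div ?posrE ?mulr_gt0 ?ltr0n // ler_ln ?posrE ?divr_gt0 ?mulr_gt0 ?ltr0n //.
  by rewrite -mulrA ler_pM2l.
have := gap l ln2l.
have h1 : c0 * (n%:R * l - ln (2 * N%:R)) <= c0 * - ln (2 * `|mu|).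
  by rewrite ler_pM2l //; lra.
have X2d : 0 <= X2 * (2 * d%:R) by rewrite mulr_ge0 // mulr_ge0.
have h2 : e * ln (1 + q%:R * c1) <= e * (l + ln (2 * c1)) by rewrite ler_wpM2l.
have h3 : X2 * (2 * d%:R) * (ln (q%:R * c1) + 1 + e * ln (1 + q%:R * c1)) <=
    X2 * (2 * d%:R) * ((1 + e) * l + (ln c1 + 1 + e * ln (2 * c1))).
  by rewrite ler_wpM2l // lnq1; lra.
rewrite mulrA; lra.
Qed.
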